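(* Let $$u_n=\sqrt{2\log n}-\frac{\frac12\log\log n+\log(2\sqrt\pi)}{\sqrt{2\log n}}.$$ If $n\to\infty$ (through the integers) while $\alpha>0$ stays fixed, then $$\int_{-\infty}^{\infty}\varphi^{\alpha}(t)\,\Phi^n(t)\,\mathrm dt=\frac{u_n^{\alpha-1}\Gamma(\alpha)+u_n^{\alpha-3}(\alpha-1)(\Gamma(\alpha)-\Gamma'(\alpha))+o(u_n^{\alpha-3})}{n^{\alpha}},$$ $$\int_{0}^{\infty}\varphi^{\alpha}(t)\,(2\Phi(t)-1)^n\,\mathrm dt=\frac{u_{2n}^{\alpha-1}\Gamma(\alpha)+u_{2n}^{\alpha-3}(\alpha-1)(\Gamma(\alpha)-\Gamma'(\alpha))+o(u_{2n}^{\alpha-3})}{(2n)^{\alpha}}.$$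
   Context: $\varphi(t)=\frac{1}{\sqrt{2\pi}}e^{-t^2/2}$ and $\Phi(t)=\int_{-\infty}^t\varphi(s)\,\mathrm ds$ are the standard normal density and distribution function; $\varphi^\alpha(t)=(\varphi(t))^\alpha$, $\Phi^n(t)=(\Phi(t))^n$. $\Gamma$ is the Gamma function. $u_{2n}$ is obtained from the formula for $u_n$ by replacing $n$ by $2n$. *)

(* Defs.v *)
From mathcomp Require Import all_boot all_order all_algebra.
From mathcomp Require Import all_classical all_reals all_analysis.
Set Implicit Arguments.
Unset Strict Implicit.
Unset Printing Implicit Defensive.
Import Order.TTheory GRing.Theory Num.Theory.
Import numFieldNormedType.Exports.

Local Open Scope classical_set_scope.
Local Open Scope ring_scope.

Section Definitions.
Context {R : realType}.
Local Notation mu := (@lebesgue_measure R).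
Implicit Types (t x : R) (n : nat).

Definition phi t : R := normal_pdf 0 1 t.

Lemma phiE t : phi t = (Num.sqrt (2 * pi))^-1 * expR (- (t ^+ 2 / 2)).
Proof.
rewrite /phi normal_pdfE ?oner_eq0//.
rewrite /normal_peak /normal_fun.
by rewrite subr0 expr1n mul1r mulr_natl mulNr.
Qed.

Definition Phi t : R := \int[mu]_(s in `]-oo, t]) phi s.

Definition Gamma x : R := \int[mu]_(s in `]0, +oo[) (s `^ (x - 1) * expR (- s)).

(* Only meaningful for n >= 2: ln is 0 on nonpositive reals and _^-1 is 0 at 0,
   so the values at n = 0, 1 are junk. *)
Definition u n : R :=
  Num.sqrt (2 * ln n%:R)
  - (2^-1 * ln (ln n%:R) + ln (2 * Num.sqrt pi)) / Num.sqrt (2 * ln n%:R).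

End Definitions.

(* Main.v *)
(** Write Q = 1 - Phi, h = phi / Q for the hazard rate, and N = k n with k = 1 for
    the first integral and k = 2 for the second (the part of the first integral
    over t < 0 is exponentially small).  Substituting Q(t) = e^-y / N gives
      int_0^oo phi^a (1 - k Q)^n dt
        = N^-a int e^(-a y) h(t)^(a-1) (1 - e^-y / n)^n dy,
    while Gamma(x) = int e^(-x y - e^-y) dy, so everything depends on comparing
    h(t) with u = u_N.  Taking logarithms in Q(t) = e^-y / N, and using the
    definition of u_N, yields the exact relation
      (h^2 - u^2) / 2 + ln (h / u) = (h^2 - t^2) / 2 + y - eps_N,   eps_N -> 0.
    Mills ratio bounds show that (h^2 - t^2) / 2 lies in [0, 2] for t >= 0 and tends
    to 1.  Both terms on the left have the sign of h - u, hence
    u^2 ((h/u)^(a-1) - 1) tends to (a - 1) (1 + y) and admits a bound uniform in n;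
    dominated convergence then produces (a - 1) (Gamma(a) - Gamma'(a)). *)

Require Import Defs.
From mathcomp Require Import all_boot all_order all_algebra ring lra.
From mathcomp Require Import all_classical all_reals all_analysis measurable_realfun.
Set Implicit Arguments.
Unset Strict Implicit.
Unset Printing Implicit Defensive.
Import Order.TTheory GRing.Theory Num.Theory.
Import numFieldNormedType.Exports.

Local Open Scope classical_set_scope.
Local Open Scope ring_scope.

(** * The normal tail *)

Section NormalTail.
Context {R : realType}.
Local Notation mu := (@lebesgue_measure R).
Implicit Types (t s : R).

(** The comparison is needed at relative order u^-2: dominated convergence is applied to u^2 times
    the difference with the Gamma integrand, so every estimate must survive a factor u^2. First, the
    crude bound h >= t yields only (h^2 - t^2) / 2 >= 0; the limit 1 requires a sharper Mills bound.
    Second, the error of (1 - e^-y / n)^n against e^(-e^-y) is of order 1/n, which u^2 <= n absorbs.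
    Third, the powers of h / u must cost less than e^(a y) as y -> +oo, where the Gamma integrand
    decays only like e^(-a y); as y -> -oo any exponential rate is harmless thanks to the factor
    e^(-e^-y). Comparing h with u through logarithms avoids an asymptotic inversion of Q. In the
    limit (a - 1) (1 + y), the 1 comes from (h^2 - t^2) / 2 and the y from the quantile; integrating
    y against the Gamma integrand gives - Gamma'(a). *)

Lemma phi_gt0 t : 0 < phi t.
Proof.
rewrite phiE mulr_gt0 ?expR_gt0// invr_gt0 sqrtr_gt0 mulr_gt0//.
exact: pi_gt0.
Qed.

Lemma phi_even t : phi (- t) = phi t.
Proof. by rewrite !phiE sqrrN. Qed.

Lemma continuous_phi : continuous (@phi R).
Proof. exact/continuous_normal_pdf/oner_neq0. Qed.

Lemma measurable_phi (D : set R) : measurable_fun D (@phi R).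
Proof. by apply: measurable_funTS; apply: continuous_measurable_fun; exact: continuous_phi. Qed.

Lemma is_derive_phi t : is_derive t 1 (@phi R) (- t * phi t).
Proof.
have -> : @phi R = (fun x => (Num.sqrt (2 * pi))^-1 * expR (- (x ^+ 2 / 2))).
  by apply/funext => x; rewrite phiE.
apply: is_derive_eq.
rewrite /GRing.scale/=; have -> : 2^-1 * (t * 1 + t * 1) = t by field.
by rewrite mulr0 mulr0 add0r; ring.
Qed.

Lemma ln_phi t : ln (phi t) = - (t ^+ 2 / 2) - ln (Num.sqrt (2 * pi)).
Proof.
have s0 : 0 < Num.sqrt (2 * pi) :> R.
  by rewrite sqrtr_gt0 mulr_gt0// pi_gt0.
rewrite phiE lnM ?posrE ?invr_gt0 ?expR_gt0//.
by rewrite lnV ?posrE// expRK addrC.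
Qed.

Lemma integrable_phi (D : set R) : measurable D ->
  mu.-integrable D (EFin \o @phi R).
Proof.
move=> mD; apply: (@integrableS _ _ _ _ setT) => //.
exact: integrable_normal_pdf.
Qed.

Lemma is_derive_Phi t : is_derive t 1 (@Phi R) (phi t).
Proof.
have tt1 : t < t + 1 by rewrite ltrDl.
have [d e] := @continuous_FTC1 R (@phi R) -oo%O t (t + 1) tt1
  (integrable_phi (measurable_itv _)) (ltNyr _) (@continuous_phi t).
by apply: DeriveDef; [exact: d|rewrite -derive1E; exact: e].
Qed.

Definition Q t : R := 1 - Phi t.

Lemma is_derive_Q t : is_derive t 1 Q (- phi t).
Proof.
have -> : Q = cst 1 - @Phi R by [].
have h := is_derive_Phi t.
rewrite -[- phi t]add0r.
exact: (is_deriveB (is_derive_cst (1:R) t 1) h).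
Qed.

Lemma continuous_Q : continuous Q.
Proof.
move=> t; apply: differentiable_continuous.
by apply/derivable1_diffP; case: (is_derive_Q t).
Qed.

Lemma continuous_Phi : continuous (@Phi R).
Proof.
move=> t; apply: differentiable_continuous.
by apply/derivable1_diffP; case: (is_derive_Phi t).
Qed.

Lemma QE t : Q t = \int[mu]_(s in `]t, +oo[) phi s.
Proof.
rewrite -(@Rintegral_itvB _ _ -oo%O +oo%O t)//; last first.
  by rewrite set_itvNyy; exact: integrable_phi.
rewrite /Q; congr (_ - _).
by rewrite set_itvNyy /Rintegral integral_normal_pdf.
Qed.

Lemma Phi_ge0 t : 0 <= Phi t.
Proof. by apply: Rintegral_ge0 => s _; exact/ltW/phi_gt0. Qed.

Lemma Q_ge0 t : 0 <= Q t.
Proof. by rewrite QE; apply: Rintegral_ge0 => s _; exact/ltW/phi_gt0. Qed.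

Lemma Phi0 : Phi 0 = 2^-1 :> R.
Proof.
suff : Phi 0 = Q 0 :> R by rewrite /Q; lra.
rewrite QE /Phi /Rintegral; congr fine.
rewrite -{1}oppr0 ge0_integration_by_substitutionNy; first last.
- by move=> x _; exact/ltW/phi_gt0.
- exact/continuous_subspaceT/continuous_phi.
rewrite integral_itv_obnd_cbnd; last by apply/measurable_EFinP; exact: measurable_phi.
by apply: eq_integral => x _ /=; rewrite phi_even.
Qed.

Lemma Q0 : Q 0 = 2^-1.
Proof. by rewrite /Q Phi0; lra. Qed.

Lemma Q_decr s t : s < t -> Q t < Q s.
Proof.
move=> st; apply: (@ltr0_derive1_decr R Q s t) => //.
- by move=> x _; case: (is_derive_Q x).
- move=> x _; rewrite derive1E; have [_ ->] := is_derive_Q x.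
  by rewrite oppr_lt0 phi_gt0.
- exact/continuous_subspaceT/continuous_Q.
Qed.

Lemma Q_gt0 t : 0 < Q t.
Proof. by apply: le_lt_trans (Q_ge0 (t + 1)) _; apply: Q_decr; rewrite ltrDl. Qed.

Lemma cvg_phi : @phi R t @[t --> +oo] --> (0 : R).
Proof.
have -> : @phi R = (fun x => (Num.sqrt (2 * pi))^-1 * expR (- (x ^+ 2 / 2))).
  by apply/funext => x; rewrite phiE.
rewrite -(mulr0 (Num.sqrt (2 * pi))^-1); apply: cvgMr.
apply: (@squeeze_cvgr _ _ _ _ (cst 0) (fun x => expR (- x))).
- near=> x; rewrite expR_ge0/= ler_expR lerN2.
  have : 2 <= x by near: x; exact: nbhs_pinfty_ge.
  nra.
- exact: cvg_cst.
- exact: cvgr_expR.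
Unshelve. all: end_near. Qed.

Lemma cvg_Q : Q t @[t --> +oo] --> (0 : R).
Proof.
apply: (@squeeze_cvgr _ _ _ _ (cst 0) (@phi R)); last exact: cvg_phi.
  near=> t; rewrite Q_ge0/=.
  have t1 : 1 <= t by near: t; exact: nbhs_pinfty_ge.
  (* For t >= 1, [phi x] is at most [x * phi x] on [t, +oo[, and the latter has antiderivative
     [- phi]; hence Q t <= phi t. *)
  have I : (\int[mu]_(x in `[t, +oo[) (x * phi x)%:E = (phi t)%:E)%E.
    rewrite (@ge0_continuous_FTC2y _ _ (fun x => - phi x) _ 0) ?EFinN ?oppeK ?add0e//.
    - by move=> x tx; rewrite mulr_ge0 ?(ltW (phi_gt0 _))//; lra.
    - apply: continuous_subspaceT => x.
      by apply: cvgM; [exact: cvg_id|exact: continuous_phi].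
    - by rewrite -oppr0; apply: cvgN; exact: cvg_phi.
    - by move=> x _; apply: derivableN; case: (is_derive_phi x).
    - apply: cvgN; apply: cvg_at_right_filter; exact: continuous_phi.
    - move=> x _; rewrite derive1E deriveN; last by case: (is_derive_phi x).
      by have [_ ->] := is_derive_phi x; rewrite mulNr opprK.
  rewrite QE Rintegral_itv_obnd_cbnd; last exact: integrable_phi.
  rewrite -lee_fin -I fineK; last exact/integrable_fin_num/integrable_phi.
  apply: ge0_le_integral => //.
  - by move=> x _; rewrite lee_fin; exact/ltW/phi_gt0.
  - by apply/measurable_EFinP; exact: measurable_phi.
  - by apply/measurable_EFinP/measurable_funM => //; exact: measurable_phi.
  - move=> x; rewrite /= in_itv/= andbT lee_fin => tx.
    by rewrite ler_peMl ?(ltW (phi_gt0 _))//; lra.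
exact: cvg_cst.
Unshelve. all: end_near. Qed.

End NormalTail.

(** * Mills ratio bounds *)

Section Mills.
Context {R : realType}.
Implicit Types (t s x : R).

Lemma is_derive_phiM (g : R -> R) t dg : is_derive t 1 g dg ->
  is_derive t 1 (@phi R * g) (phi t * (dg - t * g t)).
Proof.
move=> hg; have -> : phi t * (dg - t * g t) = phi t *: dg + g t *: (- t * phi t).
  by rewrite /GRing.scale/=; ring.
exact: (is_deriveM (is_derive_phi t) hg).
Qed.

(** If f t < 0, monotonicity keeps f below f t from t on, against the lower bound at infinity.
    Asking for an eventual lower bound instead of a limit lets the two comparison lemmas below use
    only the sign or the size of g. *)
Lemma nincr_ge0 (f : R -> R) t : (forall s, t <= s -> derivable f s 1) ->
  (forall s, t <= s -> 'D_1 f s <= 0) ->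
  (forall e, 0 < e -> \forall s \near +oo, - e <= f s) -> 0 <= f t.
Proof.
move=> df f'0 f_lim; rewrite leNgt; apply/negP => ft0.
have fe : \forall s \near +oo, f t / 2 <= f s.
  rewrite -[_ / 2]opprK; apply: f_lim; lra.
near (pinfty_nbhs R) => s.
have fs : f t / 2 <= f s by near: s.
suff : f s <= f t by lra.
have ts : t <= s by near: s; apply: nbhs_pinfty_ge; exact: num_real.
have dfs x : x \in `[t, s] -> derivable f x 1.
  by rewrite in_itv => /andP[tx _]; exact: df.
apply: (@ler0_derive1_nincr _ f t s) => //.
- by move=> x /subset_itv_oo_cc; exact: dfs.
- move=> x /subset_itv_oo_cc; rewrite in_itv => /andP[tx _]; rewrite derive1E.
  exact: f'0.
- exact: derivable_within_continuous.
Unshelve. all: end_near. Qed.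

(** The derivative of phi g - Q is phi (g' - s g + 1) <= 0, and at infinity phi g >= 0 while Q tends
    to 0. The Mills ratio Q / phi solves g' - s g = -1, so its supersolutions bound it from
    above. *)
Lemma Q_le_phiM (g dg : R -> R) t :
  (forall s, t <= s -> is_derive s 1 g (dg s)) ->
  (forall s, t <= s -> 0 <= g s) ->
  (forall s, t <= s -> dg s - s * g s <= - 1) -> Q t <= phi t * g t.
Proof.
move=> hg g0 hdg; rewrite -subr_ge0.
have hd s : t <= s -> is_derive s 1 (@phi R * g - Q) (phi s * (dg s - s * g s) - - phi s).
  move=> /hg hgs; exact: (is_deriveB (is_derive_phiM hgs) (is_derive_Q s)).
apply: (@nincr_ge0 (@phi R * g - Q)).
- by move=> s /hd[].
- move=> s ts; have [_ ->] := hd s ts; have := hdg s ts; have := phi_gt0 s; nra.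
- move=> e e0; near=> s.
  have ts : t <= s by near: s; apply: nbhs_pinfty_ge; exact: num_real.
  rewrite /= -[leLHS]add0r lerD ?mulr_ge0 ?g0 ?(ltW (phi_gt0 _))// lerN2.
  by near: s; apply: (cvgr_le _ cvg_Q).
Unshelve. all: end_near. Qed.

(** The same argument for subsolutions; here g <= 1 makes phi g at most phi, which vanishes at
    infinity. *)
Lemma Q_ge_phiM (g dg : R -> R) t :
  (forall s, t <= s -> is_derive s 1 g (dg s)) ->
  (forall s, t <= s -> g s <= 1) ->
  (forall s, t <= s -> - 1 <= dg s - s * g s) -> phi t * g t <= Q t.
Proof.
move=> hg g1 hdg; rewrite -subr_ge0.
have hd s : t <= s -> is_derive s 1 (Q - @phi R * g) (- phi s - phi s * (dg s - s * g s)).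
  move=> /hg hgs; exact: (is_deriveB (is_derive_Q s) (is_derive_phiM hgs)).
apply: (@nincr_ge0 (Q - @phi R * g)).
- by move=> s /hd[].
- move=> s ts; have [_ ->] := hd s ts; have := hdg s ts; have := phi_gt0 s; nra.
- move=> e e0; near=> s.
  have ts : t <= s by near: s; apply: nbhs_pinfty_ge; exact: num_real.
  rewrite /= -[leLHS]add0r lerD ?Q_ge0// lerN2.
  rewrite (@le_trans _ _ (phi s))//.
    by rewrite ler_piMr ?g1 ?(ltW (phi_gt0 _)).
  by near: s; apply: (cvgr_le _ cvg_phi).
Unshelve. all: end_near. Qed.

Definition hazard t : R := phi t / Q t.

Lemma hazard_gt0 t : 0 < hazard t.
Proof. by rewrite divr_gt0 ?phi_gt0 ?Q_gt0. Qed.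

Lemma is_derive_div (p q : R -> R) t dp dq : q t != 0 ->
  is_derive t 1 p dp -> is_derive t 1 q dq ->
  is_derive t 1 (fun x => p x / q x) ((dp * q t - p t * dq) / q t ^+ 2).
Proof.
move=> q0 hp hq.
have := is_deriveM hp (is_deriveV q0 hq).
by move=> /is_derive_eq; apply; rewrite /GRing.scale/=; field.
Qed.

(** The function (s^2 + 2) / (s (s^2 + 3)) = 1 / (s + 1 / (s + 2 / s)) is a convergent of Laplace's
    continued fraction for the Mills ratio. It yields h >= t + t / (t^2 + 2), sharp enough for (h^2
    - t^2) / 2 to have lower limit 1. *)
Lemma hazard_ge_div t : 0 < t -> t * (t ^+ 2 + 3) / (t ^+ 2 + 2) <= hazard t.
Proof.
move=> t0; have Qt := Q_gt0 t.
have den s : 0 < s -> 0 < s * (s ^+ 2 + 3) by move=> s0; rewrite mulr_gt0//; nra.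
suff : Q t <= phi t * ((t ^+ 2 + 2) / (t * (t ^+ 2 + 3))).
  rewrite mulrA ler_pdivlMr ?den// => h.
  by rewrite ler_pdivrMr ?[hazard _ * _]mulrAC ?ler_pdivlMr//; nra.
pose dg s : R := ((s * 2) * (s * (s ^+ 2 + 3)) - (s ^+ 2 + 2) * (3 * s ^+ 2 + 3)) /
  (s * (s ^+ 2 + 3)) ^+ 2.
apply: (@Q_le_phiM (fun s => (s ^+ 2 + 2) / (s * (s ^+ 2 + 3))) dg) => s ts.
- apply: is_derive_div.
  + by apply: lt0r_neq0; apply: den; lra.
  + by apply: is_derive_eq; rewrite /GRing.scale/=; ring.
  + by apply: is_derive_eq; rewrite /GRing.scale/=; ring.
- by rewrite divr_ge0// ?(ltW (den _ _))//; nra.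
- have s0 : 0 < s by lra.
  have -> : dg s - s * ((s ^+ 2 + 2) / (s * (s ^+ 2 + 3))) =
     - 1 - 6 / (s * (s ^+ 2 + 3)) ^+ 2.
    by rewrite /dg; field; rewrite !lt0r_neq0//; nra.
  by rewrite gerBl divr_ge0// exprn_ge0// ltW// den.
Qed.

(** Serves for t in [0, 1], where the bound t + 1/t degenerates. *)
Lemma hazard_le_add1 t : 0 <= t -> hazard t <= t + 1.
Proof.
move=> t0; rewrite ler_pdivrMr ?Q_gt0// mulrC -ler_pdivrMr; last lra.
pose dg s : R := (0 * (s + 1) - 1 * 1) / (s + 1) ^+ 2.
rewrite -[phi t]mulr1 -mulrA.
apply: (@Q_ge_phiM (fun s => 1 / (s + 1)) dg) => s ts.
- apply: is_derive_div; first by apply: lt0r_neq0; lra.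
  by apply: is_derive_eq; rewrite ?addr0.
- by rewrite ler_pdivrMr; lra.
- have -> : dg s - s * (1 / (s + 1)) = - 1 + s / (s + 1) ^+ 2.
    by rewrite /dg; field; apply: lt0r_neq0; lra.
  by rewrite lerDl divr_ge0// ?exprn_ge0//; lra.
Qed.

(** Uses the preceding convergent s / (s^2 + 1) = 1 / (s + 1 / s), which bounds the Mills ratio from
    below. *)
Lemma hazard_le_addV t : 0 < t -> hazard t <= t + t^-1.
Proof.
move=> t0; rewrite ler_pdivrMr ?Q_gt0//.
have den s : 0 < s ^+ 2 + 1 :> R by nra.
suff : phi t * (t / (t ^+ 2 + 1)) <= Q t.
  rewrite mulrA ler_pdivrMr// => h.
  have -> : t + t^-1 = (t ^+ 2 + 1) / t by field; rewrite lt0r_neq0.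
  by rewrite mulrAC ler_pdivlMr//; nra.
pose dg s : R := (1 * (s ^+ 2 + 1) - s * (s * 2)) / (s ^+ 2 + 1) ^+ 2.
apply: (@Q_ge_phiM (fun s => s / (s ^+ 2 + 1)) dg) => s ts.
- apply: is_derive_div; first exact: lt0r_neq0.
  by apply: is_derive_eq; rewrite /GRing.scale/=; ring.
- by rewrite ler_pdivrMr//; nra.
- have -> : dg s - s * (s / (s ^+ 2 + 1)) = - 1 + 2 / (s ^+ 2 + 1) ^+ 2.
    by rewrite /dg; field; apply: lt0r_neq0.
  by rewrite lerDl divr_ge0// exprn_ge0// ltW.
Qed.

Definition hgap t : R := (hazard t ^+ 2 - t ^+ 2) / 2.

Lemma hgap_lb t : 0 < t -> t ^+ 2 / (t ^+ 2 + 2) <= hgap t.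
Proof.
move=> t0; have := hazard_ge_div t0; have h0 := hazard_gt0 t.
have -> : t * (t ^+ 2 + 3) / (t ^+ 2 + 2) = t + t / (t ^+ 2 + 2).
  by field; apply: lt0r_neq0; nra.
have -> : t ^+ 2 / (t ^+ 2 + 2) = t * (t / (t ^+ 2 + 2)).
  by field; apply: lt0r_neq0; nra.
have : 0 < t / (t ^+ 2 + 2) by rewrite divr_gt0//; nra.
move: (t / _) => z z0 h; rewrite /hgap ler_pdivlMr//; nra.
Qed.

Lemma hgap_ub t : 0 < t -> hgap t <= 1 + (t ^+ 2)^-1 / 2.
Proof.
move=> t0; have := hazard_le_addV t0; have h0 := hazard_gt0 t => h.
have : hazard t ^+ 2 <= (t + t^-1) ^+ 2 by rewrite ler_sqr// nnegrE; nra.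
have -> : (t + t^-1) ^+ 2 = t ^+ 2 + 2 + (t ^+ 2)^-1 by field; apply: lt0r_neq0.
rewrite /hgap; lra.
Qed.

Lemma hgap_ge0 t : 0 <= t -> 0 <= hgap t.
Proof.
rewrite le_eqVlt => /predU1P[<-|t0]; first by rewrite /hgap expr0n subr0 divr_ge0// sqr_ge0.
by apply: le_trans (hgap_lb t0); rewrite divr_ge0//; nra.
Qed.

Lemma hgap_le2 t : 0 <= t -> hgap t <= 2.
Proof.
move=> t0; have [t1|t1] := leP t 1.
  by have := hazard_le_add1 t0; have := hazard_gt0 t; rewrite /hgap; nra.
have t0' : 0 < t by lra.
apply: le_trans (hgap_ub t0') _.
have : (t ^+ 2)^-1 <= 1 by rewrite invf_le1//; nra.
lra.
Qed.

Lemma cvg_hgap : hgap t @[t --> +oo] --> (1 : R).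
Proof.
have sqV : (t ^+ 2)^-1 @[t --> +oo] --> (0 : R).
  apply/(@gtr0_cvgV0 _ _ (pinfty_nbhs R) _ (fun t => t ^+ 2)).
    by near=> t; rewrite exprn_gt0//; near: t; exact: nbhs_pinfty_gt.
  apply: (@ger_cvgy _ _ _ _ id); last exact: cvg_id.
  near=> t; have : 1 <= t by near: t; exact: nbhs_pinfty_ge.
  by nra.
apply: (@squeeze_cvgr _ _ _ _ (fun t => 1 - 2 * (t ^+ 2)^-1) (fun t => 1 + (t ^+ 2)^-1 / 2)).
- near=> t.
  have t0 : 0 < t by near: t; exact: nbhs_pinfty_gt.
  rewrite hgap_ub// andbT; apply: le_trans (hgap_lb t0).
  have -> : t ^+ 2 / (t ^+ 2 + 2) = 1 - 2 / (t ^+ 2 + 2) by field; apply: lt0r_neq0; nra.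
  rewrite lerD2l lerN2 ler_pM2l// lef_pV2 ?posrE; nra.
- rewrite -[X in _ --> X]subr0 -[X in _ - X](mulr0 2).
  by apply: cvgB; [exact: cvg_cst|exact: cvgMr].
- rewrite -[X in _ --> X]addr0 -[X in _ + X](mul0r 2^-1).
  by apply: cvgD; [exact: cvg_cst|exact: cvgMl].
Unshelve. all: end_near. Qed.

End Mills.

(** * Substitution by the tail quantile *)

Section TailQuantile.
Context {R : realType}.
Local Notation mu := (@lebesgue_measure R).
Implicit Types (t s x y c : R).

(** On this scale the equation Q(t) = e^-y / N becomes the translation [cumhaz t] = y + ln N, and
    the derivative is the hazard rate. *)
Definition cumhaz t : R := - ln (Q t).

Lemma cumhaz0 : cumhaz 0 = ln 2.
Proof. by rewrite /cumhaz Q0 lnV ?posrE// opprK. Qed.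

Lemma expRN_cumhaz t : expR (- cumhaz t) = Q t.
Proof. by rewrite /cumhaz opprK lnK// posrE Q_gt0. Qed.

Lemma cumhaz_incr : {mono cumhaz : s t / s < t}.
Proof.
have QN : {mono (@Q R) : s t /~ s < t}.
  by apply: leW_nmono; apply: le_nmono => s t; exact: Q_decr.
by move=> s t; rewrite /cumhaz ltrN2 ltr_ln ?posrE ?Q_gt0// QN.
Qed.

Lemma is_derive_cumhaz t : is_derive t 1 cumhaz (hazard t).
Proof.
have -> : cumhaz = - (@ln R \o @Q R) by [].
have -> : hazard t = - ((Q t)^-1 * - phi t) by rewrite mulrN opprK mulrC.
by apply: is_deriveN; apply: is_derive1_comp; [exact/is_derive1_ln/Q_gt0|exact: is_derive_Q].
Qed.

Lemma continuous_cumhaz : continuous cumhaz.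
Proof.
by move=> t; apply/differentiable_continuous/derivable1_diffP; case: (is_derive_cumhaz t).
Qed.

Lemma cumhaz_surj x : ln 2 <= x -> exists2 t, 0 <= t & cumhaz t = x.
Proof.
move=> lnx.
have : \forall t \near +oo, Q t < expR (- x).
  by apply: (cvgr_lt _ cvg_Q); exact: expR_gt0.
move=> H; near (pinfty_nbhs R) => t.
have t0 : 0 <= t by near: t; apply: nbhs_pinfty_ge; exact: num_real.
have xt : x < cumhaz t.
  rewrite /cumhaz ltrNr -[X in _ < X]expRK ltr_ln ?posrE ?Q_gt0 ?expR_gt0//.
  by near: t.
have [||s] := @IVT R cumhaz 0 t x t0.
- exact/continuous_subspaceT/continuous_cumhaz.
- have l : cumhaz 0 <= cumhaz t by rewrite cumhaz0; lra.
  by rewrite min_l// max_r// cumhaz0 lnx ltW.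
by rewrite in_itv/= => /andP[s0 _] <-; exists s.
Unshelve. all: end_near. Qed.

(* Junk value 0 outside the range of [cumhaz]; only used for [x >= ln 2 = cumhaz 0]. *)
Definition tailq x : R := xget 0 [set t | cumhaz t = x].

Lemma cumhazK : cancel cumhaz tailq.
Proof.
move=> t; rewrite /tailq; case: xgetP => [s _ /= e|/(_ t)]//=.
by case: (ltgtP s t) => //; rewrite -cumhaz_incr e ltxx.
Qed.

Lemma tailqK x : ln 2 <= x -> cumhaz (tailq x) = x.
Proof. by move=> /cumhaz_surj[t _ <-]; rewrite cumhazK. Qed.

Lemma tailq_ge0 x : ln 2 <= x -> 0 <= tailq x.
Proof. by move=> /cumhaz_surj[t t0 <-]; rewrite cumhazK. Qed.

Lemma Q_tailq x : ln 2 <= x -> Q (tailq x) = expR (- x).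
Proof. by move=> h; rewrite -expRN_cumhaz tailqK. Qed.

Lemma tailq_ln2 : tailq (ln 2) = 0.
Proof. by rewrite -cumhaz0 cumhazK. Qed.

Lemma is_derive_tailq x : ln 2 <= x -> is_derive x 1 tailq (hazard (tailq x))^-1.
Proof.
move=> /cumhaz_surj[t t0 <-]; rewrite cumhazK.
apply: is_derive_inverse.
- by near=> s; exact: cumhazK.
- by near=> s; exact: continuous_cumhaz.
- exact: is_derive_cumhaz.
- by rewrite lt0r_neq0// hazard_gt0.
Unshelve. all: end_near. Qed.

Lemma continuous_tailq x : ln 2 <= x -> {for x, continuous tailq}.
Proof.
move=> h; apply/differentiable_continuous/derivable1_diffP.
by case: (is_derive_tailq h).
Qed.

Lemma cvg_tailq : tailq x @[x --> +oo] --> +oo.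
Proof.
apply/cvgryPge => A; near=> x.
have lx : ln 2 <= x by near: x; apply: nbhs_pinfty_ge; exact: num_real.
rewrite leNgt -cumhaz_incr tailqK// -leNgt.
by near: x; apply: nbhs_pinfty_ge; exact: num_real.
Unshelve. all: end_near. Qed.

Lemma continuous_hazard : continuous (@hazard R).
Proof.
move=> t; apply: cvgM; first exact: continuous_phi.
by apply: cvgV; [rewrite lt0r_neq0// Q_gt0|exact: continuous_Q].
Qed.

Lemma hazard_ge t : 0 <= t -> t <= hazard t.
Proof.
by move=> t0; have := hgap_ge0 t0; have := hazard_gt0 t; rewrite /hgap; nra.
Qed.

Lemma cvg_hazardV_tailq : (hazard (tailq x))^-1 @[x --> +oo] --> (0 : R).
Proof.
apply/(@gtr0_cvgV0 _ _ (pinfty_nbhs R) _ (@hazard R \o tailq)).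
  by apply: nearW => x; exact: hazard_gt0.
apply: (@ger_cvgy _ _ _ _ tailq); last exact: cvg_tailq.
near=> x; apply: hazard_ge; apply: tailq_ge0.
by near: x; apply: nbhs_pinfty_ge; exact: num_real.
Unshelve. all: end_near. Qed.

Lemma tailq_incr x y : ln 2 <= x -> x < y -> tailq x < tailq y.
Proof. by move=> lx xy; rewrite -cumhaz_incr !tailqK//; lra. Qed.

(* The substitution is made along [tailq] rather than [cumhaz] because the library's
   theorem on half-lines asks for a derivative with a finite limit at infinity, and
   the hazard rate is unbounded. *)
Lemma integral_tailq (G : R -> R) c : continuous G -> (forall t, 0 < t -> 0 <= G t) ->
  (\int[mu]_(t in `[0%R, +oo[) (G t)%:E =
   \int[mu]_(y in `[(ln 2 - c)%R, +oo[) (G (tailq (y + c)) / hazard (tailq (y + c)))%:E)%E.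
Proof.
move=> cG G0; pose F y := tailq (y + c).
have dF y : ln 2 - c <= y -> is_derive y 1 F (hazard (F y))^-1.
  move=> ly; have ly' : ln 2 <= y + c by lra.
  rewrite -[_^-1]mulr1; apply: is_derive1_comp; first exact: is_derive_tailq.
  by apply: is_derive_eq; rewrite addr0.
have F'E y : ln 2 - c <= y -> (F^`())%classic y = (hazard (F y))^-1.
  by move=> /dF[_]; rewrite derive1E.
have FVc y : ln 2 - c <= y -> {for y, continuous (fun y => (hazard (F y))^-1)}.
  move=> ly; apply: cvgV; first by rewrite lt0r_neq0// hazard_gt0.
  apply: continuous_cvg; first exact: continuous_hazard.
  by apply/differentiable_continuous/derivable1_diffP; case: (dF _ ly).
have nearF' y : ln 2 - c < y -> \forall z \near y, (hazard (F z))^-1 = (F^`())%classic z.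
  move=> ly; near=> z; rewrite F'E//.
  by near: z; exact: lt_le_nbhsr.
have Fa : F (ln 2 - c) = 0 by rewrite /F subrK tailq_ln2.
rewrite -[in LHS]Fa (@increasing_ge0_integration_by_substitutiony _ F).
- apply: eq_integral => y; rewrite inE/= in_itv/= andbT => ly.
  by rewrite !fctE F'E.
- move=> x y; rewrite !in_itv/= !andbT => lx _ xy; apply: tailq_incr; lra.
- move=> y; rewrite in_itv/= andbT => ly.
  have e := nearF' y ly.
  rewrite /continuous_at (F'E _ (ltW ly)).
  by apply: cvg_trans (FVc _ (ltW ly)); apply: near_eq_cvg.
- apply/cvg_ex; exists (hazard (F (ln 2 - c)))^-1.
  apply: cvg_trans (cvg_at_right_filter (FVc _ (lexx _))).
  apply: near_eq_cvg; near=> z; rewrite F'E//.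
- apply/cvg_ex; exists 0.
  have lim : (hazard (F z))^-1 @[z --> +oo] --> (0 : R).
    apply: (cvg_comp (fun z => z + c) (fun x => (hazard (tailq x))^-1));
      last exact: cvg_hazardV_tailq.
    exact: cvg_addrr.
  apply: cvg_trans lim; apply: near_eq_cvg; near=> z.
  have lz : ln 2 - c <= z by near: z; apply: nbhs_pinfty_ge; exact: num_real.
  by rewrite (F'E _ lz).
- split.
    by move=> y; rewrite in_itv/= andbT => ly; case: (dF _ (ltW ly)).
  apply: cvg_at_right_filter.
  by apply/differentiable_continuous/derivable1_diffP; case: (dF _ (lexx _)).
- apply: (cvg_comp (fun z => z + c) tailq); last exact: cvg_tailq.
  exact: cvg_addrr.
- exact: continuous_subspaceT.
- by move=> t; rewrite Fa in_itv/= andbT; exact: G0.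
Unshelve. all: end_near. Qed.

End TailQuantile.

(** * The Gamma function and its derivative *)

Section GammaExp.
Context {R : realType}.
Local Notation mu := (@lebesgue_measure R).
Implicit Types (s x y z : R).

(* The integrand of Gamma after the substitution s = e^-y. *)
Definition gker x y : R := expR (- (x * y) - expR (- y)).

Lemma gker_gt0 x y : 0 < gker x y. Proof. exact: expR_gt0. Qed.

Lemma gkerD x z y : gker (x + z) y = expR (- (z * y)) * gker x y.
Proof. by rewrite /gker -expRD; congr expR; ring. Qed.

Lemma continuous_gker x : continuous (gker x).
Proof.
move=> y; apply: continuous_cvg; first exact: continuous_expR.
apply: cvgB; first by apply: cvgN; apply: cvgMr; exact: cvg_id.
by apply: continuous_cvg; [exact: continuous_expR|apply: cvgN; exact: cvg_id].
Qed.

Lemma measurable_gker x (D : set R) : measurable_fun D (gker x).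
Proof.
by apply: measurable_funTS; apply: continuous_measurable_fun; exact: continuous_gker.
Qed.

(** The substitution s = e^-y is made on the intervals [e^-n, e^n], the images of [-n, n], and
    monotone convergence passes to the limit. The identity thus holds in [0, +oo] for every real
    x. *)
Lemma integral_Gamma_gker x :
  (\int[mu]_(s in `]0%R, +oo[) (s `^ (x - 1) * expR (- s))%:E =
   \int[mu]_y (gker x y)%:E)%E.
Proof.
pose G s : R := expR ((x - 1) * ln s - s).
have cG s : 0 < s -> {for s, continuous G}.
  move=> s0; apply: continuous_cvg; first exact: continuous_expR.
  by apply: cvgB; [apply: cvgMr; exact: continuous_ln|exact: cvg_id].
transitivity (\int[mu]_(s in `]0%R, +oo[) (G s)%:E)%E.
  apply: eq_integral => s; rewrite inE/= in_itv/= andbT => s0.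
  by rewrite /powR gt_eqF// -expRD.
pose F y : R := expR (- y).
have dF y : is_derive y 1 F (- F y).
  by rewrite -mulrN1; apply: is_derive1_comp.
have F'E : (F^`())%classic = (fun y => - F y).
  by apply/funext => y; rewrite derive1E; have [_ ->] := dF y.
have cF : continuous F.
  by move=> y; apply/differentiable_continuous/derivable1_diffP; case: (dF y).
have cF' : continuous (F^`())%classic.
  by rewrite F'E => y; apply: cvgN; exact: cF.
pose A n : set R := `[expR (- (n%:R)), expR n%:R]%classic.
pose B n : set R := `[- (n%:R), n%:R]%classic.
have sub (n : nat) : (\int[mu]_(s in A n) (G s)%:E = \int[mu]_(y in B n) (gker x y)%:E)%E.
  have n0 : - (n%:R) <= n%:R :> R by rewrite (@le_trans _ _ 0)// oppr_le0.
  have -> : A n = `[F n%:R, F (- (n%:R))]%classic by rewrite /A /F opprK.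
  rewrite (@integration_by_substitution_decreasing _ F G (- (n%:R)) n%:R n0).
  - apply: eq_integral => y _; rewrite F'E !fctE opprK /G /F expRK -expRD /gker.
    by congr (expR _)%:E; ring.
  - by move=> y z _ _; rewrite /F ltr_expR ltrN2.
  - by move=> y _; exact: cF'.
  - by apply/cvg_ex; eexists; apply: cvg_at_right_filter; exact: cF'.
  - by apply/cvg_ex; eexists; apply: cvg_at_left_filter; exact: cF'.
  - split; first by move=> y _; case: (dF y).
    + by apply: cvg_at_right_filter; exact: cF.
    + by apply: cvg_at_left_filter; exact: cF.
  - apply: continuous_in_subspaceT => s; rewrite inE/= in_itv/= => /andP[s1 _].
    by apply: cG; apply: lt_le_trans s1; exact: expR_gt0.
have UA : \bigcup_n A n = `]0, +oo[%classic.
  apply/seteqP; split => s /=.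
    move=> [n _]; rewrite /A /= !in_itv/= andbT => /andP[+ _].
    by apply: lt_le_trans; exact: expR_gt0.
  rewrite in_itv/= andbT => s0.
  exists (Num.truncn `|ln s|).+1 => //; rewrite /A/= in_itv/=.
  have h := truncnS_gt `|ln s|.
  rewrite -{2 3}(lnK s0) !ler_expR.
  by rewrite -ler_norml ltW.
have UB : \bigcup_n B n = [set: R].
  apply/seteqP; split => s //= _.
  exists (Num.truncn `|s|).+1 => //; rewrite /B/= in_itv/=.
  have h := truncnS_gt `|s|.
  by rewrite -ler_norml ltW.
have le_nat (m n : nat) : (m <= n)%N -> (m%:R <= n%:R :> R) by rewrite ler_nat.
pose D : set R := `]0, +oo[%classic.
have mG : measurable_fun D G.
  apply: open_continuous_measurable_fun; first exact: interval_open.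
  by move=> s; rewrite inE /D/= in_itv/= andbT => s0; exact: cG.
have mA n : measurable_fun (A n) (fun s => (G s)%:E).
  apply/measurable_EFinP; apply: measurable_funS mG; first exact: measurable_itv.
  by rewrite /D -UA; exact: bigcup_sup.
have hA : (\int[mu]_(s in A n) (G s)%:E @[n --> \oo] --> \int[mu]_(s in \bigcup_n A n) (G s)%:E)%E.
  apply: ge0_nondecreasing_set_cvg_integral => //.
  - move=> m n mn; apply/subsetPset; apply: subset_itv; rewrite bnd_simp ler_expR ?lerN2; exact: le_nat.
  - by move=> n; exact: measurable_itv.
  - by move=> n s _; rewrite lee_fin expR_ge0.
have hB : (\int[mu]_(s in B n) (gker x s)%:E @[n --> \oo] --> \int[mu]_(s in \bigcup_n B n) (gker x s)%:E)%E.
  apply: ge0_nondecreasing_set_cvg_integral => //.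
  - move=> m n mn; apply/subsetPset; apply: subset_itv; rewrite bnd_simp ?lerN2; exact: le_nat.
  - by move=> n; exact: measurable_itv.
  - by move=> n; apply/measurable_EFinP; exact: measurable_gker.
  - by move=> n s _; rewrite lee_fin ltW// gker_gt0.
rewrite -UA -UB; apply: (cvg_unique (@ereal_hausdorff R) hA).
by move: hB; under eq_fun do rewrite -sub.
Qed.

Lemma integral_expRN_norm x : 0 < x ->
  (\int[mu]_y (expR (- (x * `|y|)))%:E = (2 / x)%:E)%E.
Proof.
move=> x0; rewrite ge0_symfun_integralT//; first last.
- by move=> y /=; rewrite normrN.
- move=> y; apply: continuous_cvg; first exact: continuous_expR.
  by apply: cvgN; apply: cvgMr; apply: cvg_norm; exact: cvg_id.
pose F y := - (x^-1 * expR (- (x * y))).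
have dF y : is_derive y 1 F (expR (- (x * y))).
  apply: is_derive_eq; rewrite /GRing.scale/=; field.
  by rewrite lt0r_neq0.
rewrite EFinM; congr (_ * _)%E; rewrite -set_itvcy.
transitivity (\int[mu]_(y in `[0%R, +oo[) (expR (- (x * y)))%:E)%E.
  apply: eq_integral => y; rewrite inE/= in_itv/= andbT => y0.
  by rewrite ger0_norm.
rewrite (@ge0_continuous_FTC2y _ _ F _ 0).
- by rewrite /F mulr0 oppr0 expR0 mulr1 EFinN oppeK add0e.
- by move=> y _; exact: expR_ge0.
- apply: continuous_subspaceT => y; apply: continuous_cvg; first exact: continuous_expR.
  by apply: cvgN; apply: cvgMr; exact: cvg_id.
- rewrite -oppr0 -(mulr0 x^-1); apply: cvgN; apply: cvgMr.
  apply: (cvg_comp (fun y => x * y) (fun z => expR (- z))); last exact: cvgr_expR.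
  exact: gt0_cvgMry.
- by move=> y _; case: (dF y).
- apply: cvg_at_right_filter.
  by apply/differentiable_continuous/derivable1_diffP; case: (dF 0).
- by move=> y _; rewrite derive1E; have [_ ->] := dF y.
Qed.

Lemma gker_le x : 0 < x -> exists C, forall y, gker x y <= C * expR (- (x * `|y|)).
Proof.
(* For y < 0, e^-y >= 1 + y^2 / 2 reduces the claim to - 2 x y <= 2 x^2 + y^2 / 2, which is (y + 2
   x)^2 >= 0. *)
move=> x0; exists (expR (2 * x ^+ 2)) => y; rewrite -expRD ler_expR.
have := expR_ge0 (- y); have [y0|y0] := leP 0 y.
  by rewrite ger0_norm//; have := sqr_ge0 x; lra.
rewrite ltr0_norm// => _.
have := @expR_ge1Dxn _ (- y) 1.
rewrite expr2 /= => /(_ _)/wrap[|h]; first lra.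
rewrite (_ : 2`!%:R = 2 :> R)// in h.
by have := sqr_ge0 (y + 2 * x); nra.
Qed.

Lemma integrable_gker x : 0 < x -> mu.-integrable setT (EFin \o gker x).
Proof.
move=> x0; have [C gC] := gker_le x0.
have C0 : 0 <= C.
  have := gC 0; rewrite normr0 mulr0 oppr0 expR0 mulr1; apply: le_trans.
  exact/ltW/gker_gt0.
have me : measurable_fun setT (fun y : R => expR (- (x * `|y|))).
  apply: continuous_measurable_fun => y; apply: continuous_cvg; first exact: continuous_expR.
  by apply: cvgN; apply: cvgMr; apply: cvg_norm; exact: cvg_id.
apply/integrableP; split; first by apply/measurable_EFinP; exact: measurable_gker.
apply: (@le_lt_trans _ _ (\int[mu]_y (C%:E * (expR (- (x * `|y|)))%:E))%E).
  apply: ge0_le_integral => //.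
  - by apply: measurableT_comp => //; apply/measurable_EFinP; exact: measurable_gker.
  - by apply/measurable_EFinP; exact: measurable_funM.
  - by move=> y _; rewrite /= lee_fin ger0_norm ?(ltW (gker_gt0 _ _))//.
rewrite ge0_integralZl//.
- by rewrite integral_expRN_norm// -EFinM ltry.
- by apply/measurable_EFinP.
Qed.

Lemma GammaE x : Gamma x = \int[mu]_y gker x y.
Proof. by rewrite /Gamma /Rintegral integral_Gamma_gker. Qed.

End GammaExp.

Section GammaDerive.
Context {R : realType}.
Local Notation mu := (@lebesgue_measure R).
Implicit Types (x y e : R).

(** Trades the factor |y| in the derivative of [gker] for shifts of its parameter by e and -e. *)
Lemma normr_le_expR e y : 0 < e -> `|y| <= e^-1 * (expR (e * y) + expR (- (e * y))).
Proof.
move=> e0; rewrite mulrC ler_pdivlMr//.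
have h1 := expR_ge1Dx (e * y); have h2 := expR_ge1Dx (- (e * y)).
have h3 := expR_ge0 (e * y); have h4 := expR_ge0 (- (e * y)).
by case: (ger0P y) => y0; nra.
Qed.

Lemma is_derive_gker x y : is_derive x 1 (gker ^~ y) (- y * gker x y).
Proof.
apply: is_derive_eq; rewrite /GRing.scale/= /gker; ring.
Qed.

(** For x in [a/2, 2a], monotonicity of e^(- x y) in x bounds [gker x] by the sum of its values at
    the endpoints. Absorbing |y| with e = a/4 shifts a/2 and 2a by a/4 both ways; all four resulting
    parameters are positive, hence integrable. *)
Definition gker_dom (a y : R) : R := 4 / a *
  (gker (a / 4) y + gker (3 * a / 4) y + gker (7 * a / 4) y + gker (9 * a / 4) y).

Lemma normr_gker_le a x y : 0 < a -> a / 2 <= x <= 2 * a ->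
  `|- y * gker x y| <= gker_dom a y.
Proof.
move=> a0 /andP[xl xu]; rewrite normrM normrN (ger0_norm (ltW (gker_gt0 _ _))).
have h1 : gker x y <= gker (a / 2) y + gker (2 * a) y.
  have [y0|y0] := leP 0 y.
    rewrite -[leLHS]addr0 lerD ?(ltW (gker_gt0 _ _))// ler_expR lerD2r; nra.
  rewrite -[leLHS]add0r lerD ?(ltW (gker_gt0 _ _))// ler_expR lerD2r; nra.
have e0 : 0 < a / 4 by lra.
have h2 := normr_le_expR y e0.
apply: le_trans (ler_pM _ _ h2 h1) _ => //; first exact/ltW/gker_gt0.
rewrite /gker_dom.
have -> : a / 4 = a / 2 + - (a / 4) by field.
have -> : 3 * a / 4 = a / 2 + a / 4 by field.
have -> : 7 * a / 4 = 2 * a + - (a / 4) by field.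
have -> : 9 * a / 4 = 2 * a + a / 4 by field.
rewrite !gkerD.
have -> : a / 2 - a / 4 = a / 4 by field.
rewrite mulNr opprK.
by rewrite le_eqVlt; apply/orP; left; apply/eqP; field; rewrite lt0r_neq0.
Qed.

Lemma integrable_gker_dom a : 0 < a -> mu.-integrable setT (EFin \o gker_dom a).
Proof.
move=> a0.
have -> : EFin \o gker_dom a = (fun y => (4 / a)%:E * ((gker (a / 4) y)%:E +
  (gker (3 * a / 4) y)%:E + (gker (7 * a / 4) y)%:E + (gker (9 * a / 4) y)%:E))%E.
  by apply/funext => y; rewrite /= /gker_dom EFinM !EFinD.
apply: integrableZl => //.
do 3 (apply: integrableD => //; last by apply: integrable_gker; lra).
by apply: integrable_gker; lra.
Qed.

Lemma integrable_mul_gker a : 0 < a -> mu.-integrable setT (fun y => (- y * gker a y)%:E).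
Proof.
move=> a0; apply: le_integrable (integrable_gker_dom a0) => //.
  apply/measurable_EFinP; apply: measurable_funM; last exact: measurable_gker.
  exact: oppr_measurable.
move=> y _; rewrite !lee_fin /=; apply: le_trans (ler_norm _).
by apply: normr_gker_le => //; lra.
Qed.

Lemma derive1_Gamma a : 0 < a ->
  (@Gamma R)^`()%classic a = \int[mu]_y (- y * gker a y).
Proof.
move=> a0.
have d1 x y : partial1of2 gker x y = - y * gker x y.
  by rewrite partial1of2E; have [_ ->] := is_derive_gker x y.
transitivity ((fun x => \int[mu]_y gker x y)^`()%classic a).
  by congr (_^`() a)%classic; apply/funext => x; exact: GammaE.
have I x : `](a / 2), (2 * a)[%classic x -> a / 2 <= x <= 2 * a.
  by rewrite /= in_itv/= => /andP[? ?]; apply/andP; split; exact: ltW.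
rewrite (@differentiation_under_integral R _ _ mu gker setT measurableT a (a / 2) (2 * a) _ _ _ (gker_dom a)).
- by apply: eq_Rintegral => y _; exact: d1.
- by rewrite /= in_itv/=; lra.
- by move=> x /I ?; apply: integrable_gker; lra.
- by move=> x y _ _; case: (is_derive_gker x y).
- by move=> y; rewrite mulr_ge0 ?divr_ge0 ?(ltW a0)// !addr_ge0// ltW// gker_gt0.
- exact: integrable_gker_dom.
- by move=> x y /I ? _; rewrite d1; exact: normr_gker_le.
Qed.

End GammaDerive.

(** * The centering sequence *)

Section Centering.
Context {R : realType}.
Implicit Types (L x y : R).

Lemma cvg_sqrty : Num.sqrt x @[x --> +oo] --> (+oo : set_system R).
Proof.
apply/cvgryPge => A; near=> x.
have Ax : `|A| ^+ 2 <= x by near: x; apply: nbhs_pinfty_ge; exact: num_real.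
apply: le_trans (ler_norm A) _.
by rewrite -normr_id -sqrtr_sqr ler_wsqrtr.
Unshelve. all: end_near. Qed.

Lemma ln_sqrt x : 0 <= x -> ln (Num.sqrt x) = ln x / 2.
Proof. by move=> x0; rewrite -powR12_sqrt// ln_powR mulrC. Qed.

Definition ucorr L : R := (2^-1 * ln L + ln (2 * Num.sqrt pi)) / Num.sqrt (2 * L).
(* [u] as a function of [L = ln n], cf. [uE]. *)
Definition uln L : R := Num.sqrt (2 * L) - ucorr L.

Lemma uE n : u n = uln (ln n%:R) :> R. Proof. by []. Qed.

Lemma ln_2sqrtpi_ge0 : 0 <= ln (2 * Num.sqrt pi) :> R.
Proof.
apply: ln_ge0; have := @pi_ge2 R => h.
have : 1 <= Num.sqrt pi :> R by rewrite -sqrtr1 ler_wsqrtr//; lra.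
lra.
Qed.

Lemma ucorr_ge0 L : 1 <= L -> 0 <= ucorr L.
Proof.
move=> L1; rewrite divr_ge0// addr_ge0 ?ln_2sqrtpi_ge0// mulr_ge0//.
exact: ln_ge0.
Qed.

Lemma cvg_ucorr : ucorr L @[L --> +oo] --> (0 : R).
Proof.
pose c : R := ln (2 * Num.sqrt pi).
(* With v = L^(1/4), ln L = 4 ln v <= 4 v while the denominator is sqrt 2 v^2, so the quotient is at
   most (2 + c) / v once v >= 1. *)
pose v L : R := Num.sqrt (Num.sqrt L).
have vy : v L @[L --> +oo] --> (+oo : set_system R).
  by apply: cvg_comp cvg_sqrty; exact: cvg_sqrty.
have vV : (v L)^-1 @[L --> +oo] --> (0 : R).
  apply/(@gtr0_cvgV0 _ _ (pinfty_nbhs R) _ v) => //.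
  near=> L; rewrite !sqrtr_gt0; near: L; exact: nbhs_pinfty_gt.
apply: (@squeeze_cvgr _ _ _ _ (cst 0) (fun L => (2 + c) * (v L)^-1)); last 2 first.
- exact: cvg_cst.
- by rewrite -(mulr0 (2 + c)); exact: cvgMr.
near=> L.
have L1 : 1 <= L by near: L; exact: nbhs_pinfty_ge.
rewrite ucorr_ge0//=.
have s1 : 1 <= Num.sqrt L by rewrite -sqrtr1 ler_wsqrtr.
have v1 : 1 <= v L by rewrite -sqrtr1 /v ler_wsqrtr.
have c0 : 0 <= c := ln_2sqrtpi_ge0.
have lnv : ln L = 4 * ln (v L).
  have L0 : 0 <= L by lra.
  by rewrite /v !ln_sqrt ?sqrtr_ge0//; field.
have lv : ln (v L) <= v L by apply/ltW/ln_sublinear; lra.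
have sL : Num.sqrt L = v L ^+ 2 by rewrite sqr_sqrtr// sqrtr_ge0.
have s2 : 1 <= Num.sqrt 2 :> R by rewrite -[leLHS]sqrtr1 ler_wsqrtr//; lra.
rewrite /ucorr sqrtrM// sL lnv -/c.
rewrite ler_pdivrMr; last by rewrite mulr_gt0 ?exprn_gt0//; lra.
have -> : (2 + c) / v L * (Num.sqrt 2 * v L ^+ 2) = (2 + c) * v L * Num.sqrt 2.
  by field; apply: lt0r_neq0; lra.
apply: (@le_trans _ _ ((2 + c) * v L)); last first.
  by rewrite ler_peMr// mulr_ge0//; lra.
nra.
Unshelve. all: end_near. Qed.

Lemma cvg_sqrt2M : Num.sqrt (2 * L) @[L --> +oo] --> (+oo : set_system R).
Proof. by apply: cvg_comp cvg_sqrty; apply: gt0_cvgMry. Qed.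

Lemma cvg_uln : uln L @[L --> +oo] --> (+oo : set_system R).
Proof.
apply: (@ger_cvgy _ _ _ _ (fun L => Num.sqrt (2 * L) - 1)); last first.
  by apply: (cvg_comp (fun L => Num.sqrt (2 * L)) (fun x => x - 1) cvg_sqrt2M); exact: cvg_addrr.
near=> L; rewrite lerD2l lerN2.
near: L; apply: (cvgr_le _ cvg_ucorr); exact: ltr01.
Unshelve. all: end_near. Qed.

(* With L = ln n and v = uln L, e^(- uerr L) = n phi(v) / v. *)
Definition uerr L : R := uln L ^+ 2 / 2 + ln (uln L) - L + ln (Num.sqrt (2 * pi)).

(** This is what the correction in u is designed for. With w = sqrt (2 L) and x = [ucorr L], (w -
    x)^2 / 2 = L - x w + x^2 / 2, and x w equals ln w + ln (sqrt (2 pi)). What remains is x^2 / 2 +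
    ln (1 - x / w), which vanishes with x. *)
Lemma cvg_uerr : uerr L @[L --> +oo] --> (0 : R).
Proof.
have sV : (Num.sqrt (2 * L))^-1 @[L --> +oo] --> (0 : R).
  apply/(@gtr0_cvgV0 _ _ (pinfty_nbhs R) _ (fun L => Num.sqrt (2 * L))); last exact: cvg_sqrt2M.
  near=> L; rewrite sqrtr_gt0 mulr_gt0//; near: L; exact: nbhs_pinfty_gt.
have xw : ucorr L * (Num.sqrt (2 * L))^-1 @[L --> +oo] --> (0 : R).
  by rewrite -(mulr0 0); apply: cvgM => //; exact: cvg_ucorr.
have lim : ucorr L ^+ 2 / 2 + ln (1 - ucorr L * (Num.sqrt (2 * L))^-1) @[L --> +oo] --> (0 : R).
  have -> : 0 = 0 ^+ 2 / 2 + ln (1 - 0) :> R by rewrite expr0n mul0r subr0 ln1 addr0.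
  apply: cvgD.
    by apply: cvgMl; apply: (@cvgM _ _ _ _ (@ucorr) (@ucorr)); exact: cvg_ucorr.
  apply: continuous_cvg; first by rewrite subr0; exact/continuous_ln/ltr01.
  by apply: cvgB => //; exact: cvg_cst.
apply: cvg_trans lim; apply: near_eq_cvg; near=> L.
have L0 : 0 < L by near: L; exact: nbhs_pinfty_gt.
have : ucorr L * (Num.sqrt (2 * L))^-1 < 1 by near: L; apply: (cvgr_lt _ xw); exact: ltr01.
set w := Num.sqrt (2 * L); set x := ucorr L => xw1.
have w0 : 0 < w by rewrite sqrtr_gt0; lra.
have w2 : w ^+ 2 = 2 * L by rewrite sqr_sqrtr//; lra.
have xwE : x * w = 2^-1 * ln L + ln (2 * Num.sqrt pi) by rewrite /x /ucorr divfK// lt0r_neq0.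
have -> : uerr L = (w - x) ^+ 2 / 2 + ln (w * (1 - x / w)) - L + ln (Num.sqrt (2 * pi)).
  by rewrite /uerr /uln -/w -/x; congr (_ + ln _ - _ + _); field; rewrite lt0r_neq0.
rewrite lnM ?posrE ?subr_gt0//.
have -> : (w - x) ^+ 2 / 2 = L - x * w + x ^+ 2 / 2.
  by rewrite (_ : L = w ^+ 2 / 2); [field|rewrite w2; field].
have p0 := @pi_gt0 R.
rewrite xwE {1}/w !ln_sqrt; [|lra|lra].
rewrite !lnM ?posrE ?sqrtr_gt0// ln_sqrt; last lra.
by field.
Unshelve. all: end_near. Qed.

Lemma uln_le L : 1 <= L -> uln L <= Num.sqrt (2 * L).
Proof. by move=> L1; rewrite gerBl ucorr_ge0. Qed.

End Centering.

(** * Comparing the hazard rate with the centering sequence *)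

Section Perturbation.
Context {R : realType}.
Implicit Types (u h E l b y z K : R).

Lemma norm_expRB1_le z : `|expR z - 1| <= `|z| * expR `|z|.
Proof.
have h1 := expR_ge1Dx z; have h2 := expR_ge1Dx (- z).
have z1 : expR z - 1 <= z * expR z.
  have := expRxMexpNx_1 z; have := expR_gt0 z; nra.
case: (ger0P z) => z0.
  by rewrite ger0_norm//; lra.
rewrite ler0_norm; last by rewrite subr_le0 expR_le1 ltW.
have : 1 <= expR (- z) by rewrite -expR0 ler_expR; lra.
nra.
Qed.

Lemma norm_expRB1Bx_le z : `|expR z - 1 - z| <= z ^+ 2 * expR `|z|.
Proof.
have h1 := expR_ge1Dx z; have h2 := expR_ge1Dx (- z).
have z1 : expR z - 1 <= z * expR z.
  have := expRxMexpNx_1 z; have := expR_gt0 z; nra.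
rewrite ger0_norm; last lra.
apply: (@le_trans _ _ (`|z| * `|expR z - 1|)).
  by rewrite -normrM; apply: (@le_trans _ _ (z * (expR z - 1))); [lra|exact: ler_norm].
have -> : z ^+ 2 = `|z| * `|z| by rewrite -expr2 real_normK// num_real.
by rewrite -mulrA ler_wpM2l//; exact: norm_expRB1_le.
Qed.

(* For h = u e^l this is (h^2 - u^2) / 2 + ln (h / u), cf. [log_balanceE]. *)
Definition log_balance u l : R := u ^+ 2 * (expR (2 * l) - 1) / 2 + l.

Lemma log_balanceE u h : 0 < u -> 0 < h ->
  log_balance u (ln (h / u)) = (h ^+ 2 - u ^+ 2) / 2 + ln h - ln u.
Proof.
move=> u0 h0; rewrite /log_balance expRM_natl lnK ?posrE ?divr_gt0//.
by rewrite ln_div ?posrE//; field; rewrite lt0r_neq0.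
Qed.

Lemma log_balance_ge u l : u ^+ 2 * l + l <= log_balance u l.
Proof.
have := expR_ge1Dx (2 * l); have := sqr_ge0 u; rewrite /log_balance; nra.
Qed.

Lemma log_balance_lt0 u l : l < 0 -> log_balance u l <= l.
Proof.
move=> l0; have : expR (2 * l) <= 1 by rewrite expR_le1; lra.
have := sqr_ge0 u; rewrite /log_balance; nra.
Qed.

(** From e^(2 l) <= 1 / (1 + 2 (-l)) one gets 2 (-l) <= (1 - e^(2 l)) (1 + 2 (-l)). The factor u^2
    (1 - e^(2 l)) / 2 is then bounded by - E, with E the balance, and so is - l. *)
Lemma log_balance_neg u l : l < 0 ->
  u ^+ 2 * - l <= - log_balance u l * (1 + 2 * - log_balance u l).
Proof.
move=> l0; have El := log_balance_lt0 u l0.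
have h := expR_ge1Dx (- (2 * l)); have p := expRxMexpNx_1 (2 * l).
have e0 := expR_gt0 (2 * l).
have q : (1 - expR (2 * l)) * (1 + 2 * - l) >= 2 * - l by nra.
have e1 : expR (2 * l) <= 1 by rewrite expR_le1; lra.
have u0 := sqr_ge0 u.
have s : u ^+ 2 * (1 - expR (2 * l)) / 2 <= - log_balance u l by rewrite /log_balance; lra.
apply: (@le_trans _ _ (u ^+ 2 * (1 - expR (2 * l)) / 2 * (1 + 2 * - l))).
  have : u ^+ 2 * (2 * - l) <= u ^+ 2 * ((1 - expR (2 * l)) * (1 + 2 * - l)).
    exact: ler_wpM2l.
  lra.
apply: ler_pM => //; [|lra|lra].
by rewrite divr_ge0// mulr_ge0//; lra.
Qed.

(** Inverts the balance: a bounded E forces l to be O(u^-2). *)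
Lemma log_balance_norm u l : let E := log_balance u l in
  u ^+ 2 * `|l| <= `|E| * (1 + 2 * `|E|) /\ `|l| <= `|E|.
Proof.
move=> E; have u0 := sqr_ge0 u; case: (ger0P l) => l0.
  have := log_balance_ge u l; rewrite -/E => hE.
  have E0 : 0 <= E by nra.
  by rewrite ger0_norm//; split; nra.
have := log_balance_neg u l0; have := log_balance_lt0 u l0; rewrite -/E => h1 h2.
by rewrite ler0_norm; [split; lra|lra].
Qed.

(** Two linearisations: u^2 l differs from E, and u^2 (e^(b l) - 1) from b u^2 l, by l itself and by
    quadratic remainders of size u^2 l^2. Since u^2 |l| <= K, each error is O(|l|), that is O(K /
    u^2). *)
Lemma log_balance_approx u l b K : 1 <= u -> `|log_balance u l| * (1 + 2 * `|log_balance u l|) <= K ->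
  `|u ^+ 2 * (expR (b * l) - 1) - b * log_balance u l| <=
  (`|b| * (1 + 2 * K * expR (2 * K)) + b ^+ 2 * K * expR (`|b| * K)) * K / u ^+ 2.
Proof.
move=> u1; have [] := log_balance_norm u l; set E := log_balance u l => h1 h2 hK.
have u2 : 1 <= u ^+ 2 by rewrite exprn_ege1.
have lK : u ^+ 2 * `|l| <= K by exact: le_trans h1 hK.
have l0 := normr_ge0 l.
have lK' : `|l| <= K by nra.
have K0 : 0 <= K by exact: le_trans lK'.
have T1 : `|u ^+ 2 * l - E| <= (1 + 2 * K * expR (2 * K)) * `|l|.
  have -> : u ^+ 2 * l - E = - (u ^+ 2 / 2 * (expR (2 * l) - 1 - 2 * l)) - l.
    by rewrite /E /log_balance; field.
  apply: le_trans (ler_normB _ _) _; rewrite normrN normrM [`|u ^+ 2 / 2|]ger0_norm; last lra.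
  have := norm_expRB1Bx_le (2 * l); rewrite normrM (ger0_norm (_ : 0 <= 2))// => h.
  have e1 : expR (2 * `|l|) <= expR (2 * K) by rewrite ler_expR; lra.
  have : u ^+ 2 / 2 * `|expR (2 * l) - 1 - 2 * l| <= u ^+ 2 / 2 * ((2 * l) ^+ 2 * expR (2 * K)).
    apply: ler_wpM2l; first lra.
    by apply: le_trans h _; rewrite ler_wpM2l// sqr_ge0.
  have -> : u ^+ 2 / 2 * ((2 * l) ^+ 2 * expR (2 * K)) = 2 * (u ^+ 2 * `|l|) * `|l| * expR (2 * K).
    have -> : (2 * l) ^+ 2 = 4 * (`|l| * `|l|) by rewrite -expr2 real_normK ?num_real//; ring.
    by field.
  have : (u ^+ 2 * `|l|) * (`|l| * expR (2 * K)) <= K * (`|l| * expR (2 * K)).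
    by rewrite ler_wpM2r// mulr_ge0// expR_ge0.
  lra.
have T2 : `|u ^+ 2 * (expR (b * l) - 1 - b * l)| <= b ^+ 2 * K * expR (`|b| * K) * `|l|.
  rewrite normrM ger0_norm ?sqr_ge0//.
  have := norm_expRB1Bx_le (b * l); rewrite normrM => h.
  have e1 : expR (`|b| * `|l|) <= expR (`|b| * K) by rewrite ler_expR ler_wpM2l.
  apply: (@le_trans _ _ (u ^+ 2 * ((b * l) ^+ 2 * expR (`|b| * K)))).
    apply: ler_wpM2l; first exact: sqr_ge0.
    by apply: le_trans h _; rewrite ler_wpM2l// sqr_ge0.
  have -> : u ^+ 2 * ((b * l) ^+ 2 * expR (`|b| * K)) = (u ^+ 2 * `|l|) * (b ^+ 2 * expR (`|b| * K) * `|l|).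
    have -> : (b * l) ^+ 2 = b ^+ 2 * (`|l| * `|l|) by rewrite -expr2 real_normK ?num_real//; ring.
    by ring.
  have -> : b ^+ 2 * K * expR (`|b| * K) * `|l| = K * (b ^+ 2 * expR (`|b| * K) * `|l|) by ring.
  apply: ler_wpM2r => //; apply: mulr_ge0 => //.
  by apply: mulr_ge0; [exact: sqr_ge0|exact: expR_ge0].
have -> : u ^+ 2 * (expR (b * l) - 1) - b * E =
    b * (u ^+ 2 * l - E) + u ^+ 2 * (expR (b * l) - 1 - b * l) by ring.
apply: le_trans (ler_normD _ _) _; rewrite normrM.
set c1 := 1 + _ in T1 *; set c2 := b ^+ 2 * K * _ in T2 *.
have c10 : 0 <= c1 by rewrite addr_ge0// !mulr_ge0// expR_ge0.
have c20 : 0 <= c2.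
  by apply: mulr_ge0; [apply: mulr_ge0 => //; exact: sqr_ge0|exact: expR_ge0].
have lu : `|l| <= K / u ^+ 2 by rewrite ler_pdivlMr; [rewrite mulrC|lra].
apply: (@le_trans _ _ ((`|b| * c1 + c2) * `|l|)).
  rewrite mulrDl lerD// -mulrA ler_wpM2l//.
by rewrite -[leRHS]mulrA ler_wpM2l// addr_ge0// mulr_ge0.
Qed.

(* For l >= 0 the growth rate in y is [2 e], which can be made smaller than [a]; the
   large rate [3 + `|b|] only occurs for l < 0, where y is bounded above and e^-y
   bounds the integrand doubly exponentially. *)
Lemma log_balance_dom u l b y e : 0 < e -> `|b| <= e * u ^+ 2 -> 1 <= u ->
  `|log_balance u l - y| <= 3 ->
  `|u ^+ 2 * (expR (b * l) - 1)| <=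
  `|b| / e * expR (6 * e) * expR (2 * e * y) + `|b| * expR (3 * (3 + `|b|)) * expR (- ((3 + `|b|) * y)).
Proof.
move=> e0 be u1; set E := log_balance u l => /ler_normlP[E1 E2].
have u2 : 1 <= u ^+ 2 by rewrite exprn_ege1.
rewrite normrM ger0_norm ?sqr_ge0//.
have b0 := normr_ge0 b.
have main : u ^+ 2 * `|expR (b * l) - 1| <= `|b| * (u ^+ 2 * `|l|) * expR (`|b| * `|l|).
  have := norm_expRB1_le (b * l); rewrite normrM => h.
  rewrite [leRHS](_ : _ = u ^+ 2 * (`|b| * `|l| * expR (`|b| * `|l|))); last by ring.
  by rewrite ler_wpM2l//; lra.
apply: le_trans main _; case: (ger0P l) => l0.
- rewrite -[leLHS]addr0; apply: lerD; last by rewrite !mulr_ge0// expR_ge0.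
  have hE : u ^+ 2 * l <= E by have := log_balance_ge u l; rewrite -/E; lra.
  have E0 : 0 <= E by nra.
  have eE : E <= e^-1 * expR (e * E).
    by rewrite mulrC ler_pdivlMr//; have := expR_ge1Dx (e * E); lra.
  (* The assumption on b makes the exponent small relative to E: |b| l <= e u^2 l <= e E. A second e
     E pays for the linear factor E, whence the rate 2 e. *)
  have bl : `|b| * l <= e * E by nra.
  apply: (@le_trans _ _ (`|b| * (e^-1 * expR (e * E)) * expR (e * E))).
    apply: ler_pM; [by rewrite !mulr_ge0//; lra|exact: expR_ge0| |by rewrite ler_expR].
    by rewrite ler_wpM2l//; exact: le_trans hE eE.
  rewrite [leLHS](_ : _ = `|b| / e * expR (2 * e * E)); last first.
    by rewrite (_ : 2 * e * E = e * E + e * E); [rewrite expRD; ring|ring].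
  rewrite -[leRHS]mulrA -expRD; apply: ler_wpM2l; first by rewrite divr_ge0// ltW.
  by rewrite ler_expR; nra.
- rewrite -[leLHS]add0r; apply: lerD; first by rewrite !mulr_ge0// ?expR_ge0// invr_ge0 ltW.
  have hE := log_balance_neg u l0; have El := log_balance_lt0 u l0; rewrite -/E in hE El.
  have E0 : 0 <= - E by lra.
  (* The factors - E, 1 + 2 (- E) and e^(|b| (- E)) contribute rates 1, 2 and |b|, which sum to 3 +
     |b|; then - E <= 3 - y. *)
  have x1 := expR_ge1Dx (- E); have x2 := expR_ge1Dx (2 * - E).
  apply: (@le_trans _ _ (`|b| * (expR (- E) * expR (2 * - E)) * expR (`|b| * - E))).
    apply: ler_pM; [by rewrite !mulr_ge0//; lra|exact: expR_ge0| |by rewrite ler_expR ler_wpM2l//; lra].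
    rewrite ler_wpM2l//; apply: le_trans hE _; apply: ler_pM => //; lra.
  rewrite -[leRHS]mulrA -expRD -!mulrA -!expRD; apply: ler_wpM2l => //.
  rewrite ler_expR; nra.
Qed.

Lemma bernoulli_le z (n : nat) : 0 <= z <= 1 -> 1 - n%:R * z <= (1 - z) ^+ n.
Proof.
move=> /andP[z0 z1]; elim: n => [|n ih]; first by rewrite expr0 mul0r subr0.
have : 0 <= (1 - z) ^+ n <= 1 by rewrite exprn_ge0 ?exprn_ile1//; lra.
have : 0 <= n%:R * z :> R by rewrite mulr_ge0.
rewrite exprS -natr1; nra.
Qed.

(** For x = z / n, e^-x (1 + x) <= 1 gives 1 - x >= e^-x (1 - x^2). Taking n-th powers, Bernoulli
    bounds (1 - x^2)^n below by 1 - z^2 / n. *)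
Lemma exp_approx z (n : nat) : (0 < n)%N -> 0 <= z <= n%:R ->
  expR (- z) * (1 - z ^+ 2 / n%:R) <= (1 - z / n%:R) ^+ n <= expR (- z).
Proof.
move=> n0 /andP[z0 zn]; have n0' : 0 < n%:R :> R by rewrite ltr0n.
pose x := z / n%:R.
have x0 : 0 <= x by rewrite divr_ge0// ltW.
have x1 : x <= 1 by rewrite ler_pdivrMr// mul1r.
have ez : expR (- z) = expR (- x) ^+ n.
  by rewrite -expRM_natl; congr expR; rewrite /x; field; rewrite lt0r_neq0.
have h1 := expR_ge1Dx x; have h2 := expR_ge1Dx (- x).
apply/andP; split; last by rewrite ez -/x lerXn2r ?nnegrE ?expR_ge0//; lra.
have hx : expR (- x) * (1 - x ^+ 2) <= 1 - x.
  have := expRxMexpNx_1 x; have := expR_gt0 (- x) => e0 e1.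
  have : expR (- x) * (1 + x) <= 1 by nra.
  nra.
have x2 : 0 <= x ^+ 2 <= 1 by rewrite exprn_ge0// exprn_ile1.
apply: (@le_trans _ _ ((expR (- x) * (1 - x ^+ 2)) ^+ n)); last first.
  have p1 : 0 <= expR (- x) * (1 - x ^+ 2) by rewrite mulr_ge0 ?expR_ge0//; lra.
  by rewrite -/x lerXn2r ?nnegrE//; lra.
rewrite exprMn -ez ler_wpM2l ?expR_ge0//.
apply: le_trans (bernoulli_le n x2).
rewrite le_eqVlt; apply/orP; left; apply/eqP.
by rewrite /x; field; rewrite lt0r_neq0.
Qed.

End Perturbation.

(** * Dominated convergence *)

Section Main.
Context {R : realType}.
Local Notation mu := (@lebesgue_measure R).
Variables (a : R) (k : nat).
Hypotheses (a0 : 0 < a) (k0 : (0 < k)%N) (k2 : (k <= 2)%N).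
Implicit Types (n : nat) (t y : R).

Let L n : R := ln (k * n)%:R.
Let U n : R := u (k * n).
Let D n : set R := `[ln 2 - L n, +oo[%classic.
Let hz n y : R := hazard (tailq (y + L n)).
Let ell n y : R := ln (hz n y / U n).
Let W n y : R := expR (- (a * y)) * expR ((a - 1) * ell n y) * (1 - expR (- y) / n%:R) ^+ n.

Let UE n : U n = uln (L n). Proof. exact: uE. Qed.

Let kR0 : 0 < k%:R :> R. Proof. by rewrite ltr0n. Qed.

Let kR2 : k%:R <= 2 :> R. Proof. by rewrite -[2]/(2%:R) ler_nat. Qed.

Let inD n y : D n y -> ln 2 <= y + L n.
Proof. by rewrite /D/= in_itv/= andbT; lra. Qed.

Let ker_itg t n : R := phi t `^ a * (1 - k%:R * Q t) ^+ n.

Let ker_itgE t n : ker_itg t n = expR (a * ln (phi t)) * (1 - k%:R * Q t) ^+ n.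
Proof. by rewrite /ker_itg /powR gt_eqF// phi_gt0. Qed.

Let continuous_ker_itg n : continuous (ker_itg ^~ n).
Proof.
have -> : ker_itg ^~ n = (fun t => expR (a * ln (phi t)) * (1 - k%:R * Q t) ^+ n).
  by apply/funext => t; exact: ker_itgE.
move=> t; apply: cvgM.
  apply: continuous_cvg; first exact: continuous_expR.
  apply: cvgMr; apply: continuous_cvg; first exact/continuous_ln/phi_gt0.
  exact: continuous_phi.
apply: (cvg_comp (fun t => 1 - k%:R * Q t) (fun x => x ^+ n)); last exact: exprn_continuous.
by apply: cvgB; [exact: cvg_cst|apply: cvgMr; exact: continuous_Q].
Qed.

Lemma tail_integralE n : (0 < n)%N -> 0 < U n ->
  (\int[mu]_(t in `[0%R, +oo[) (ker_itg t n)%:E =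
   \int[mu]_(y in D n) (((k * n)%:R `^ (- a) * U n `^ (a - 1)) * W n y)%:E)%E.
Proof.
move=> n0 Un0; rewrite (@integral_tailq _ (ker_itg ^~ n) (L n)) //; last first.
  move=> t t0; rewrite mulr_ge0 ?powR_ge0// exprn_ge0//.
  have := Q_decr t0; rewrite Q0; have := ler_wpM2r (Q_ge0 t) kR2; lra.
apply: eq_integral => y; rewrite inE => /inD lx; congr EFin.
have n0' : 0 < n%:R :> R by rewrite ltr0n.
have N0 : 0 < (k * n)%:R :> R by rewrite ltr0n muln_gt0 k0.
have h0 : 0 < hz n y := hazard_gt0 _.
have QE : Q (tailq (y + L n)) = expR (- y) / (k * n)%:R.
  by rewrite Q_tailq// opprD expRD expRN [expR (- L n)]expRN lnK// expRN.
have lnphi : ln (phi (tailq (y + L n))) = ln (hz n y) - (y + L n).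
  rewrite /hz /hazard ln_div ?posrE ?phi_gt0 ?Q_gt0// Q_tailq// expRK; ring.
rewrite ker_itgE lnphi -/(hz n y) /W QE natrM.
have -> : 1 - k%:R * (expR (- y) / (k%:R * n%:R)) = 1 - expR (- y) / n%:R.
  by field; rewrite !lt0r_neq0.
rewrite mulrAC mulrA; congr (_ * _).
rewrite -natrM /powR !gt_eqF// -/(L n) -!expRD -[X in _ / X]lnK ?posrE// -expRN -expRD.
by congr expR; rewrite /ell ln_div ?posrE//; ring.
Qed.

Let balance n y : 0 < U n -> D n y ->
  log_balance (U n) (ell n y) = hgap (tailq (y + L n)) + y - uerr (L n).
Proof.
move=> Un0 /inD lx; rewrite log_balanceE ?hazard_gt0// /hz.
(* Only the hazard under the logarithm is unfolded: ln h becomes - t^2 / 2 - ln (sqrt (2 pi)) + y +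
   L, while h^2 is left to form [hgap]. *)
rewrite {2}/hazard ln_div ?posrE ?phi_gt0 ?Q_gt0// Q_tailq// expRK ln_phi.
by rewrite /uerr /hgap -UE; field.
Qed.

(** The first two terms are [log_balance_dom] with b = a - 1 and e = a/4, multiplied by [gker a]:
    the rate 2 e = a/2 leaves the positive parameter a/2. The last one covers the error of the n-th
    power, of size e^(-2 y), and the complement of [D n], where u^2 <= n <= n^2 <= 4 e^(-2 y). *)
Let dom y : R := `|a - 1| / (a / 4) * expR (6 * (a / 4)) * gker (a / 2) y +
  `|a - 1| * expR (3 * (3 + `|a - 1|)) * gker (a + (3 + `|a - 1|)) y + 4 * gker (a + 2) y.

Let integrable_dom : mu.-integrable setT (EFin \o dom).
Proof.
have -> : EFin \o dom = (fun y =>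
    (`|a - 1| / (a / 4) * expR (6 * (a / 4)))%:E * (gker (a / 2) y)%:E +
    (`|a - 1| * expR (3 * (3 + `|a - 1|)))%:E * (gker (a + (3 + `|a - 1|)) y)%:E +
    4%:E * (gker (a + 2) y)%:E)%E.
  by apply/funext => y; rewrite /= /dom !EFinD !EFinM.
have a_gt0 := a0; have b0 := normr_ge0 (a - 1).
apply: integrableD => //; last by apply: integrableZl => //; apply: integrable_gker; lra.
by apply: integrableD => //; apply: integrableZl => //; apply: integrable_gker; lra.
Qed.

(** The third bound is the smallness condition of [log_balance_dom] for e = a/4, the fourth keeps
    the balance within 3 of y, and the last absorbs u^2 into errors of order 1/n. *)
Definition in_regime n := [/\ (0 < n)%N, 1 <= U n, `|a - 1| <= a / 4 * U n ^+ 2,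
  `|uerr (L n)| <= 1 & U n ^+ 2 <= n%:R].

Let gker_expR y : expR (- (a * y)) * expR (- expR (- y)) = gker a y.
Proof. by rewrite -expRD. Qed.

Let gker_sq y : expR (- y) ^+ 2 * gker a y = gker (a + 2) y.
Proof. by rewrite gkerD -expRM_natl; congr (expR _ * _); ring. Qed.

(** On [D n], e^-y = N Q(t) <= N / 2 = k n / 2, and k <= 2. So the base 1 - e^-y / n lies in
    [0, 1]. *)
Let inD_le n y : (0 < n)%N -> D n y -> expR (- y) <= n%:R.
Proof.
move=> n0 /inD lx.
have N0 : 0 < (k * n)%:R :> R by rewrite ltr0n muln_gt0 k0.
have : expR (- y) <= expR (L n - ln 2) by rewrite ler_expR; lra.
rewrite expRB !lnK ?posrE// natrM => h; apply: le_trans h _.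
by rewrite ler_pdivrMr// mulrC ler_wpM2l.
Qed.

Let notinD_ge n y : (0 < n)%N -> ~ D n y -> n%:R <= 2 * expR (- y).
Proof.
move=> n0; rewrite /D/= in_itv/= andbT => /negP; rewrite -ltNge => lx.
have N0 : 0 < (k * n)%:R :> R by rewrite ltr0n muln_gt0 k0.
have : expR (L n - ln 2) <= expR (- y) by rewrite ler_expR; lra.
rewrite expRB !lnK ?posrE// natrM ler_pdivrMr//.
have : 1 <= k%:R :> R by rewrite ler1n.
have : 0 <= n%:R :> R by [].
nra.
Qed.

Let W_dom n y : in_regime n -> `|U n ^+ 2 * ((W n \_ (D n)) y - gker a y)| <= dom y.
Proof.
move=> [n0 U1 bU er Un]; have a_gt0 := a0.
have n0' : 0 < n%:R :> R by rewrite ltr0n.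
have U2 : 1 <= U n ^+ 2 by rewrite exprn_ege1.
have s0 := expR_gt0 (- y).
have g0 := gker_gt0 a y.
have b0 := normr_ge0 (a - 1).
have B1 : 0 <= `|a - 1| / (a / 4) * expR (6 * (a / 4)) * gker (a / 2) y.
  by rewrite !mulr_ge0 ?expR_ge0 ?invr_ge0//; lra.
have B2 : 0 <= `|a - 1| * expR (3 * (3 + `|a - 1|)) * gker (a + (3 + `|a - 1|)) y.
  by rewrite !mulr_ge0 ?expR_ge0.
have [Dy|nDy] := pselect (D n y); last first.
  rewrite patchE memNset// sub0r mulrN normrN ger0_norm; last by rewrite mulr_ge0//; lra.
  rewrite /dom -gker_sq.
  have h := notinD_ge n0 nDy.
  have : n%:R * 1 <= n%:R * n%:R :> R by rewrite ler_wpM2l// ler1n.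
  have : n%:R * n%:R <= (2 * expR (- y)) * (2 * expR (- y)) by apply: ler_pM.
  move=> h1 h2.
  have : U n ^+ 2 * gker a y <= (4 * (expR (- y) ^+ 2)) * gker a y.
    by apply: ler_wpM2r; [exact: ltW|rewrite expr2; lra].
  lra.
rewrite patchE mem_set//.
have sn := inD_le n0 Dy.
have sn' : 0 <= expR (- y) <= n%:R by rewrite sn ltW.
have /andP[w1 w2] := exp_approx n0 sn'.
rewrite /W; set w := (1 - expR (- y) / n%:R) ^+ n in w1 w2 *.
have w0 : 0 <= w.
  by rewrite exprn_ge0// subr_ge0 ler_pdivrMr// mul1r.
set P := expR ((a - 1) * _).
(* Separates the replacement of h by u from that of the n-th power by its exponential limit. *)
have -> : U n ^+ 2 * (expR (- (a * y)) * P * w - gker a y) =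
   expR (- (a * y)) * w * (U n ^+ 2 * (P - 1)) + expR (- (a * y)) * (U n ^+ 2 * (w - expR (- expR (- y)))).
  by rewrite -gker_expR; ring.
have ea := expR_gt0 (- (a * y)).
have bal := balance (lt_le_trans ltr01 U1) Dy.
(* The constant 3 is 2 from [hgap] plus 1 from [uerr]. *)
have Ey : `|log_balance (U n) (ell n y) - y| <= 3.
  have t0 := tailq_ge0 (inD Dy).
  have h1 := hgap_ge0 t0; have h2 := hgap_le2 t0.
  move: er => /ler_normlP[e1 e2].
  by rewrite bal; apply/ler_normlP; split; lra.
have e0 : 0 < a / 4 by lra.
have B := log_balance_dom e0 bU U1 Ey.
apply: le_trans (ler_normD _ _) _; rewrite /dom; apply: lerD.
  rewrite normrM ger0_norm; last by rewrite mulr_ge0// ltW.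
  apply: (@le_trans _ _ (gker a y * `|U n ^+ 2 * (P - 1)|)).
    by apply: ler_wpM2r => //; rewrite -gker_expR ler_wpM2l// ltW.
  apply: le_trans (ler_wpM2l (ltW g0) B) _.
  have -> : gker (a / 2) y = expR (2 * (a / 4) * y) * gker a y.
    by rewrite /gker -expRD; congr expR; field.
  by rewrite gkerD; lra.
rewrite normrM ger0_norm; last exact: ltW.
rewrite normrM ger0_norm; last lra.
rewrite ler0_norm; last by rewrite subr_le0.
rewrite opprB -gker_sq -gker_expR.
have : U n ^+ 2 * (expR (- expR (- y)) - w) <= n%:R * (expR (- expR (- y)) * (expR (- y) ^+ 2 / n%:R)).
  by apply: ler_pM => //; [lra|rewrite subr_ge0|rewrite lerBlDr -lerBlDl; lra].
have -> : n%:R * (expR (- expR (- y)) * (expR (- y) ^+ 2 / n%:R)) = expR (- expR (- y)) * expR (- y) ^+ 2.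
  by field; rewrite lt0r_neq0.
move=> h; apply: le_trans (ler_wpM2l (ltW ea) h) _.
have : 0 <= expR (- (a * y)) * (expR (- expR (- y)) * expR (- y) ^+ 2).
  by rewrite !mulr_ge0 ?expR_ge0.
lra.
Qed.

(** * Limits of the centering quantities *)

Let ge_half n : (0 < n)%N -> expR (L n) <= 2 * n%:R.
Proof.
move=> n0; have N0 : 0 < (k * n)%:R :> R by rewrite ltr0n muln_gt0 k0.
by rewrite lnK ?posrE// natrM ler_wpM2r.
Qed.

Let cvgL : L n @[n --> \oo] --> (+oo : set_system R).
Proof.
apply/cvgryPge => A; near=> n.
have n0 : (0 < n)%N by near: n; exact: nbhs_infty_gt.
have An : expR A <= n%:R by near: n; exact: nbhs_infty_ger.
have N0 : 0 < (k * n)%:R :> R by rewrite ltr0n muln_gt0 k0.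
rewrite -[leLHS]expRK ler_ln ?posrE ?expR_gt0//; apply: le_trans An _.
by rewrite ler_nat leq_pmull.
Unshelve. all: end_near. Qed.

Let cvgU : U n @[n --> \oo] --> (+oo : set_system R).
Proof.
have -> : U = (fun n => uln (L n)) by apply/funext => n; exact: UE.
exact: (cvg_comp L (@uln R) cvgL (@cvg_uln R)).
Qed.

Let cvg_er : uerr (L n) @[n --> \oo] --> (0 : R).
Proof. exact: (cvg_comp L (@uerr R) cvgL (@cvg_uerr R)). Qed.

Let cvgU2n : U n ^+ 2 / n%:R @[n --> \oo] --> (0 : R).
Proof.
have LV : (L n)^-1 @[n --> \oo] --> (0 : R).
  apply/(@gtr0_cvgV0 _ _ \oo _ L); last exact: cvgL.
  by move/cvgryPgt : cvgL; exact.
(* U^2 <= 2 L, and L^2 / 2 <= e^L <= 2 n gives 2 L^2 <= 8 n. *)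
apply: (@squeeze_cvgr _ _ _ _ (cst 0) (fun n => 8 * (L n)^-1)); last 2 first.
- exact: cvg_cst.
- by rewrite -(mulr0 8); exact: cvgMr.
near=> n.
have n0 : (0 < n)%N by near: n; exact: nbhs_infty_gt.
have n0' : 0 < n%:R :> R by rewrite ltr0n.
have L1 : 1 <= L n by near: n; move/cvgryPge : cvgL; exact.
have U0 : 0 <= U n by near: n; move/cvgryPge : cvgU; exact.
rewrite divr_ge0 ?sqr_ge0//=.
have U2 : U n ^+ 2 <= 2 * L n.
  have : U n <= Num.sqrt (2 * L n) by rewrite UE; exact: uln_le.
  rewrite -(@ler_sqr _ (U n)) ?nnegrE ?sqrtr_ge0// sqr_sqrtr//; lra.
have L0 : 0 <= L n by lra.
have := @expR_ge1Dxn _ (L n) 1 L0; rewrite (_ : 2`!%:R = 2 :> R)// => eL.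
have := ge_half n0 => h.
have L2 : 0 < L n by lra.
rewrite ler_pdivrMr// mulrAC ler_pdivlMr//.
apply: (@le_trans _ _ (2 * L n ^+ 2)).
  by rewrite expr2 mulrA ler_wpM2r.
lra.
Unshelve. all: end_near. Qed.

Let near_good : \forall n \near \oo, in_regime n.
Proof.
have b0 := normr_ge0 (a - 1); have a_gt0 := a0.
near=> n.
have n0 : (0 < n)%N by near: n; exact: nbhs_infty_gt.
have n0' : 0 < n%:R :> R by rewrite ltr0n.
have U1 : 1 <= U n by near: n; move/cvgryPge : cvgU; exact.
have Ub : `|a - 1| / (a / 4) <= U n by near: n; move/cvgryPge : cvgU; exact.
split => //.
- move: Ub; rewrite ler_pdivrMr ?divr_gt0// mulrC => Ub.
  apply: le_trans Ub _; apply: ler_wpM2l; first lra.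
  by rewrite expr2 ler_peMl//; lra.
- rewrite -[uerr _]subr0 distrC; near: n.
  by move/cvgrPdist_le : cvg_er; apply; exact: ltr01.
- rewrite -[leRHS]mul1r -ler_pdivrMr//; near: n.
  by apply: (cvgr_le _ cvgU2n); exact: ltr01.
Unshelve. all: end_near. Qed.

Let near_D y : \forall n \near \oo, D n y.
Proof.
near=> n; rewrite /D/= in_itv/= andbT lerBlDr -lerBlDl.
by near: n; move/cvgryPge : cvgL; exact.
Unshelve. all: end_near. Qed.

(** * Pointwise limit of the rescaled difference *)

Let E_cvg y : hgap (tailq (y + L n)) + y - uerr (L n) @[n --> \oo] --> 1 + y.
Proof.
rewrite -[1 + y]subr0; apply: cvgB; last exact: cvg_er.
apply: cvgD; last exact: cvg_cst.
apply: (cvg_comp (fun n => tailq (y + L n)) (@hgap R)); last exact: cvg_hgap.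
apply: (cvg_comp (fun n => y + L n) (@tailq R)); last exact: cvg_tailq.
by apply: (cvg_comp L (fun x => y + x) cvgL); exact: cvg_addrl.
Qed.

Let P_cvg y : U n ^+ 2 * (expR ((a - 1) * ell n y) - 1) @[n --> \oo] --> (a - 1) * (1 + y).
Proof.
(* |E| <= 2 + |y| + 1, so K bounds |E| (1 + 2 |E|) independently of n. *)
pose K := (3 + `|y|) * (1 + 2 * (3 + `|y|)).
pose C := (`|a - 1| * (1 + 2 * K * expR (2 * K)) + (a - 1) ^+ 2 * K * expR (`|a - 1| * K)) * K.
pose E n := hgap (tailq (y + L n)) + y - uerr (L n).
have UV : C * (U n)^-1 @[n --> \oo] --> (0 : R).
  rewrite -(mulr0 C); apply: cvgMr.
  apply/(@gtr0_cvgV0 _ _ \oo _ U); last exact: cvgU.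
  by move/cvgryPgt : cvgU; exact.
have lim : U n ^+ 2 * (expR ((a - 1) * ell n y) - 1) - (a - 1) * E n @[n --> \oo] --> (0 : R).
  apply/norm_cvg0P.
  apply: (@squeeze_cvgr _ _ _ _ (cst 0) (fun n => C * (U n)^-1)); [|exact: cvg_cst|exact: UV].
  near=> n; rewrite normr_ge0/=.
  have [n0 U1 bU er Un] : in_regime n by near: n; exact: near_good.
  have Dy : D n y by near: n; exact: near_D.
  have bal := balance (lt_le_trans ltr01 U1) Dy.
  have Ey : `|E n| <= 3 + `|y|.
    have t0 := tailq_ge0 (inD Dy).
    have h1 := hgap_ge0 t0; have h2 := hgap_le2 t0.
    rewrite /E; apply: le_trans (ler_normB _ _) _.
    apply: le_trans (lerD (ler_normD _ _) er) _.
    by rewrite ger0_norm//; lra.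
  have := @log_balance_approx _ (U n) (ell n y) (a - 1) K U1.
  rewrite bal -/(E n) => /(_ _)/wrap[|h].
    by have := normr_ge0 (E n); rewrite /K; nra.
  apply: le_trans h _; rewrite -/C ler_wpM2l//.
    have K0 : 0 <= K by rewrite /K mulr_ge0// addr_ge0// ?mulr_ge0// addr_ge0.
    rewrite /C; apply: mulr_ge0 => //; apply: addr_ge0.
      by rewrite mulr_ge0// addr_ge0// !mulr_ge0// expR_ge0.
    by apply: mulr_ge0; [apply: mulr_ge0 => //; exact: sqr_ge0|exact: expR_ge0].
  have U0 : 0 < U n by lra.
  by rewrite lef_pV2 ?posrE ?exprn_gt0// expr2 ler_peMl// ltW.
have -> : (a - 1) * (1 + y) = 0 + (a - 1) * (1 + y) by rewrite add0r.
have lE : (a - 1) * E n @[n --> \oo] --> (a - 1) * (1 + y).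
  by apply: cvgMr; exact: E_cvg.
apply: cvg_trans (cvgD lim lE); apply: near_eq_cvg; near=> n.
by rewrite !fctE subrK.
Unshelve. all: end_near. Qed.

Let expn_cvg y : (1 - expR (- y) / n%:R) ^+ n @[n --> \oo] --> expR (- expR (- y)).
Proof.
have nV : expR (- y) ^+ 2 / n%:R @[n --> \oo] --> (0 : R).
  rewrite -(mulr0 (expR (- y) ^+ 2)); apply: cvgMr.
  apply/(@gtr0_cvgV0 _ _ \oo _ (fun n => n%:R)); last exact: cvgr_idn.
  by near=> n; rewrite ltr0n; near: n; exact: nbhs_infty_gt.
apply: (@squeeze_cvgr _ _ _ _
  (fun n => expR (- expR (- y)) * (1 - expR (- y) ^+ 2 / n%:R)) (cst (expR (- expR (- y))))).
- near=> n.
  have n0 : (0 < n)%N by near: n; exact: nbhs_infty_gt.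
  have Dy : D n y by near: n; exact: near_D.
  by apply: exp_approx => //; rewrite expR_ge0 inD_le.
- have : expR (- expR (- y)) * (1 - expR (- y) ^+ 2 / n%:R) @[n --> \oo] -->
      expR (- expR (- y)) * (1 - 0).
    by apply: cvgMr; apply: cvgB => //; exact: cvg_cst.
  by rewrite subr0 mulr1.
- exact: cvg_cst.
Unshelve. all: end_near. Qed.

Let expn_err_cvg y :
  U n ^+ 2 * ((1 - expR (- y) / n%:R) ^+ n - expR (- expR (- y))) @[n --> \oo] --> (0 : R).
Proof.
pose C := expR (- expR (- y)) * expR (- y) ^+ 2.
apply: (@squeeze_cvgr _ _ _ _ (fun n => - (C * (U n ^+ 2 / n%:R))) (cst 0)).
- near=> n.
  have n0 : (0 < n)%N by near: n; exact: nbhs_infty_gt.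
  have n0' : 0 < n%:R :> R by rewrite ltr0n.
  have Dy : D n y by near: n; exact: near_D.
  have sn' : 0 <= expR (- y) <= n%:R by rewrite expR_ge0 inD_le.
  have /andP[w1 w2] := exp_approx n0 sn'.
  set w := (1 - expR (- y) / n%:R) ^+ n in w1 w2 *.
  have U0 := sqr_ge0 (U n).
  apply/andP; split; last by rewrite mulr_ge0_le0// subr_le0.
  have -> : - (C * (U n ^+ 2 / n%:R)) = U n ^+ 2 * - (expR (- expR (- y)) * (expR (- y) ^+ 2 / n%:R)).
    by rewrite /C; field; rewrite lt0r_neq0.
  by rewrite ler_wpM2l//; lra.
- rewrite -oppr0 -(mulr0 C); apply: cvgN; apply: cvgMr; exact: cvgU2n.
- exact: cvg_cst.
Unshelve. all: end_near. Qed.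

Let W_cvg y : U n ^+ 2 * ((W n \_ (D n)) y - gker a y) @[n --> \oo] -->
  gker a y * ((a - 1) * (1 + y)).
Proof.
have lim : expR (- (a * y)) * ((1 - expR (- y) / n%:R) ^+ n *
    (U n ^+ 2 * (expR ((a - 1) * ell n y) - 1)) +
    U n ^+ 2 * ((1 - expR (- y) / n%:R) ^+ n - expR (- expR (- y)))) @[n --> \oo] -->
  expR (- (a * y)) * (expR (- expR (- y)) * ((a - 1) * (1 + y)) + 0).
  apply: cvgMr; apply: cvgD; last exact: expn_err_cvg.
  by apply: cvgM; [exact: expn_cvg|exact: P_cvg].
move: lim; rewrite addr0 mulrA gker_expR => lim.
apply: cvg_trans lim; apply: near_eq_cvg; near=> n.
have Dy : D n y by near: n; exact: near_D.
by rewrite patchE mem_set// /W -gker_expR; ring.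
Unshelve. all: end_near. Qed.

(** * Passage to the limit under the integral *)

Let measurable_W n : (0 < n)%N -> 0 < U n -> measurable_fun (D n) (W n).
Proof.
move=> n0 U0; apply: subspace_continuous_measurable_fun; first exact: measurable_itv.
apply: continuous_in_subspaceT => y; rewrite inE => /inD lx.
have cT : {for y, continuous (fun z => tailq (z + L n))}.
  apply: (cvg_comp (fun z => z + L n) tailq); last exact: continuous_tailq.
  by apply: cvgD; [exact: cvg_id|exact: cvg_cst].
have cell : {for y, continuous (ell n)}.
  apply: (cvg_comp (fun z => hz n z / U n) (@ln R)); last first.
    by apply: continuous_ln; rewrite divr_gt0// hazard_gt0.
  apply: cvgMl.
  by apply: (cvg_comp (fun z => tailq (z + L n)) (@hazard R) cT); exact: continuous_hazard.
apply: cvgM; first apply: cvgM.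
- apply: continuous_cvg; first exact: continuous_expR.
  by apply: cvgN; apply: cvgMr; exact: cvg_id.
- apply: continuous_cvg; first exact: continuous_expR.
  by apply: cvgMr; exact: cell.
- apply: (cvg_comp (fun z => 1 - expR (- z) / n%:R) (fun x => x ^+ n)); last exact: exprn_continuous.
  apply: cvgB; first exact: cvg_cst.
  apply: cvgMl; apply: continuous_cvg; first exact: continuous_expR.
  by apply: cvgN; exact: cvg_id.
Qed.

(** As U^2 >= 1, the bound on U^2 (W - [gker a]) also bounds W - [gker a]. *)
Let integrable_W n : in_regime n -> mu.-integrable setT (EFin \o (W n \_ (D n))).
Proof.
move=> gn; have [n0 U1 _ _ _] := gn.
have U2 : 1 <= U n ^+ 2 by rewrite exprn_ege1.
have int_sum : mu.-integrable setT (fun y => (dom y)%:E + (gker a y)%:E)%E.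
  by apply: integrableD => //; exact: integrable_gker.
apply: le_integrable int_sum => //.
  apply/measurable_EFinP/(measurable_restrictT _ (measurable_itv _)).
  by apply: measurable_W => //; lra.
move=> y _; rewrite -EFinD !lee_fin/=; apply: le_trans (ler_norm _).
rewrite -[X in `|X|](subrK (gker a y)); apply: le_trans (ler_normD _ _) _.
apply: lerD; last by rewrite ger0_norm// ltW// gker_gt0.
apply: le_trans (W_dom y gn); rewrite normrM [`|U n ^+ 2|]ger0_norm ?sqr_ge0//.
exact: ler_peMl.
Qed.

Let w n : R := \int[mu]_(y in D n) W n y.

Let wE n : w n = \int[mu]_y (W n \_ (D n)) y.
Proof. exact: Rintegral_mkcond. Qed.

Let tail_integral_w n : in_regime n ->
  (\int[mu]_(t in `[0%R, +oo[) (ker_itg t n)%:E =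
   ((k * n)%:R `^ (- a) * U n `^ (a - 1) * w n)%:E)%E.
Proof.
move=> gn; have [n0 U1 _ _ _] := gn.
have U0 : 0 < U n by lra.
rewrite tail_integralE//.
have iW : mu.-integrable (D n) (EFin \o W n).
  apply/integrable_mkcond; first exact: measurable_itv.
  by rewrite restrict_EFin; exact: integrable_W.
under eq_integral do rewrite EFinM.
rewrite integralZl//; last exact: measurable_itv.
rewrite [in RHS]EFinM fineK//; apply: integrable_fin_num => //; exact: measurable_itv.
Qed.

Let w_cvg : U n ^+ 2 * (w n - Gamma a) @[n --> \oo] -->
  (a - 1) * (Gamma a - (@Gamma R)^`()%classic a).
Proof.
(* The domination is required at every index, so the sequence is shifted into the regime where it
   holds. *)
have [N _ goodN] := near_good.
have gN n : in_regime (n + N) by apply: goodN; exact: leq_addl.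
rewrite -(cvg_shiftn N).
pose f n y : R := U (n + N) ^+ 2 * ((W (n + N) \_ (D (n + N))) y - gker a y).
pose g y : R := gker a y * ((a - 1) * (1 + y)).
have igk : mu.-integrable setT (EFin \o gker a) by exact: integrable_gker.
have fE n : U (n + N) ^+ 2 * (w (n + N) - Gamma a) = \int[mu]_y f n y.
  have iW := integrable_W (gN n).
  rewrite wE GammaE -RintegralB// RintegralZl//.
  by rewrite (_ : EFin \o _ = (EFin \o (W (n + N) \_ (D (n + N)))) \- (EFin \o gker a))%E//;
    exact: integrableB.
have imk := integrable_mul_gker a0.
have gD y : g y = (a - 1) * (gker a y - - y * gker a y) by rewrite /g; ring.
have igB : mu.-integrable setT (EFin \o (fun y => gker a y - - y * gker a y)).
  exact: (integrableB _ igk imk).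
have ig : mu.-integrable setT (EFin \o g).
  rewrite (_ : EFin \o g = (fun y => (a - 1)%:E * (gker a y - - y * gker a y)%:E)%E).
    exact: integrableZl.
  by apply/funext => y; rewrite /= gD EFinM.
have gE : (a - 1) * (Gamma a - (@Gamma R)^`()%classic a) = \int[mu]_y g y.
  rewrite derive1_Gamma// GammaE -RintegralB// -RintegralZl//.
  by apply: eq_Rintegral => y _; rewrite gD.
rewrite gE; under eq_fun do rewrite fE.
have mf n : measurable_fun setT (fun y => (f n y)%:E).
  apply/measurable_EFinP; apply: measurable_funM; first exact: measurable_cst.
  apply: measurable_funB; last exact: measurable_gker.
  by have /measurable_int/measurable_EFinP := integrable_W (gN n).
have fg y : (f n y)%:E @[n --> \oo] --> (g y)%:E.
  apply: cvg_EFin; first exact: nearW.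
  by move: (@W_cvg y); rewrite -(cvg_shiftn N).
have fdom n y : (`|(f n y)%:E| <= (EFin \o dom) y)%E.
  by rewrite lee_fin; exact: W_dom.
have := @dominated_cvg _ _ _ mu setT measurableT (fun n y => (f n y)%:E) (fun y => (g y)%:E)
  (EFin \o dom) mf (fun y _ => fg y) (fun _ _ => erefl) integrable_dom (fun n y _ => fdom n y).
move=> h; apply: fine_cvg; rewrite fineK//.
exact: integrable_fin_num.
Qed.

(* The first integral uses k = 1, where 1 - Q = Phi, the second one k = 2, where
   1 - 2 Q = 2 Phi - 1. *)
Lemma tail_integral_asymptotics : exists v : nat -> R,
  (\forall n \near \oo, (\int[mu]_(t in `[0%R, +oo[) (phi t `^ a * (1 - k%:R * Q t) ^+ n)%:E =
     ((k * n)%:R `^ (- a) * u (k * n) `^ (a - 1) * v n)%:E)%E) /\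
  u (k * n) ^+ 2 * (v n - Gamma a) @[n --> \oo] -->
     (a - 1) * (Gamma a - (@Gamma R)^`()%classic a).
Proof.
exists w; split; last exact: w_cvg.
by near=> n; apply: tail_integral_w; near: n; exact: near_good.
Unshelve. all: end_near. Qed.

Lemma cvg_u : u (k * n) @[n --> \oo] --> (+oo : set_system R).
Proof. exact: cvgU. Qed.

Lemma u_sq_le : \forall n \near \oo, u (k * n) ^+ 2 <= n%:R :> R.
Proof. by apply: filterS near_good => n []. Qed.

End Main.

(** * The two expansions *)

Section Assembly.
Context {R : realType}.
Local Notation mu := (@lebesgue_measure R).
Implicit Types (t y : R).

(** An exact rewriting: u^(a-1) v = u^(a-1) G + u^(a-3) u^2 (v - G). The remainder is u^(a-3) times
    the distance of u^2 (v - G) from its limit c. *)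
Lemma littleo_expansion (I : nat -> \bar R) (N : nat -> nat) (v : nat -> R) (a G c : R) :
  (forall n, (0 < n)%N -> (0 < N n)%N) ->
  u (N n) @[n --> \oo] --> (+oo : set_system R) ->
  (\forall n \near \oo, I n = ((N n)%:R `^ (- a) * u (N n) `^ (a - 1) * v n)%:E) ->
  u (N n) ^+ 2 * (v n - G) @[n --> \oo] --> c ->
  exists2 r : nat -> R, r =o_\oo (fun n => u (N n) `^ (a - 3)) &
    \forall n \near \oo, I n =
      ((u (N n) `^ (a - 1) * G + u (N n) `^ (a - 3) * c + r n) / (N n)%:R `^ a)%:E.
Proof.
move=> N0 uy IE vG; exists (fun n => u (N n) `^ (a - 3) * (u (N n) ^+ 2 * (v n - G) - c)).
- apply/eqoP => e e0; near=> n.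
  rewrite normrM mulrC ler_wpM2r// distrC; near: n.
  by move/cvgrPdist_le : vG; exact.
- near=> n.
  have n0 : (0 < n)%N by near: n; exact: nbhs_infty_gt.
  have u0 : 0 < u (N n) :> R by near: n; move/cvgryPgt : uy; exact.
  have -> : I n = ((N n)%:R `^ (- a) * u (N n) `^ (a - 1) * v n)%:E by near: n.
  have -> : u (N n) `^ (a - 1) = u (N n) `^ (a - 3) * u (N n) ^+ 2.
    rewrite -powR_mulrn ?ltW// -powRD; last by rewrite (gt_eqF u0) implybT.
    by congr (_ `^ _); rewrite -[2%:R]/(2 : R); ring.
  congr EFin; rewrite powRN.
  by field; rewrite lt0r_neq0// powR_gt0// ltr0n N0.
Unshelve. all: end_near. Qed.

Lemma powR_half_cvg0 (p : R) : n%:R `^ p * 2^-1 ^+ n @[n --> \oo] --> (0 : R).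
Proof.
pose m := (Num.truncn `|p|).+1.
have l2 : 0 < ln 2 :> R by apply: ln_gt0; rewrite ltr1n.
(* With m >= |p|, the term of degree m + 1 of the series of 2^n = e^(n ln 2) beats n^p by a factor n
   / C. *)
pose C : R := (m.+1)`!%:R / ln 2 ^+ m.+1.
have nV : C * n%:R^-1 @[n --> \oo] --> (0 : R).
  rewrite -(mulr0 C); apply: cvgMr.
  apply/(@gtr0_cvgV0 _ _ \oo _ (fun n => n%:R)); last exact: cvgr_idn.
  by near=> n; rewrite ltr0n; near: n; exact: nbhs_infty_gt.
apply: (@squeeze_cvgr _ _ _ _ (cst 0) (fun n => C * n%:R^-1)); [|exact: cvg_cst|exact: nV].
near=> n.
have n0 : (0 < n)%N by near: n; exact: nbhs_infty_gt.
have n0' : 0 < n%:R :> R by rewrite ltr0n.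
rewrite mulr_ge0 ?powR_ge0 ?exprn_ge0//=.
have pm : n%:R `^ p <= n%:R ^+ m.
  rewrite -powR_mulrn//; apply: ler_powR; first by rewrite ler1n.
  by apply: le_trans (ler_norm _) _; apply/ltW/truncnS_gt.
have e2 : (n%:R * ln 2) ^+ m.+1 / (m.+1)`!%:R <= 2 ^+ n :> R.
  have : 0 <= n%:R * ln 2 :> R by rewrite mulr_ge0// ltW.
  by move=> /(@expR_ge1Dxn R _ m); rewrite expRM_natl lnK ?posrE//; lra.
have f0 : 0 < (m.+1)`!%:R :> R by rewrite ltr0n fact_gt0.
rewrite ler_pdivlMr// exprVn mulrAC ler_pdivrMr ?exprn_gt0//.
apply: (@le_trans _ _ (n%:R ^+ m.+1)); first by rewrite exprSr ler_wpM2r// ltW.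
move: e2; rewrite ler_pdivrMr// exprMn => e2.
by rewrite /C mulrAC ler_pdivlMr ?exprn_gt0// mulrC [leRHS]mulrC; lra.
Unshelve. all: end_near. Qed.

Lemma phi_powR_le (a : R) : 0 < a -> exists2 K, 0 <= K & forall t, phi t `^ a <= K * expR (- (a * `|t|)).
Proof.
(* (|t| - 1)^2 >= 0 gives - t^2 / 2 <= 1/2 - |t|; the logarithmic term is the normalisation of
   phi. *)
move=> a0; exists (expR (a / 2 - a * ln (Num.sqrt (2 * pi)))); first exact: expR_ge0.
move=> t; rewrite /powR gt_eqF ?phi_gt0// -expRD ler_expR ln_phi.
have : t ^+ 2 = `|t| ^+ 2 by rewrite real_normK// num_real.
have := sqr_ge0 (`|t| - 1); nra.
Qed.

Lemma measurable_powR_phi_Phi (a : R) n (D : set R) :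
  measurable_fun D (fun t => phi t `^ a * Phi t ^+ n).
Proof.
apply: measurable_funTS; apply: measurable_funM.
  have -> : (fun t => phi t `^ a) = (fun t => expR (a * ln (phi t))).
    by apply/funext => t; rewrite /powR gt_eqF// phi_gt0.
  apply: continuous_measurable_fun => t; apply: continuous_cvg; first exact: continuous_expR.
  apply: cvgMr; apply: continuous_cvg; first exact/continuous_ln/phi_gt0.
  exact: continuous_phi.
apply: continuous_measurable_fun => t.
by apply: (cvg_comp (@Phi R) (fun x => x ^+ n)); [exact: continuous_Phi|exact: exprn_continuous].
Qed.

(** For t < 0, Phi t <= 1/2, and phi^a is integrable by the previous exponential bound. *)
Lemma left_integral_le (a : R) : 0 < a -> exists2 M, 0 <= M & forall n,
  (\int[mu]_(t in `]-oo, 0%R[) (phi t `^ a * Phi t ^+ n)%:E <= (M * 2^-1 ^+ n)%:E)%E.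
Proof.
move=> a0; have [K K0 hK] := phi_powR_le a0.
exists (K * (2 / a)); first by rewrite mulr_ge0// divr_ge0// ltW.
move=> n.
have me : measurable_fun setT (fun y : R => expR (- (a * `|y|))).
  apply: continuous_measurable_fun => y; apply: continuous_cvg; first exact: continuous_expR.
  by apply: cvgN; apply: cvgMr; apply: cvg_norm; exact: cvg_id.
have meD (D : set R) : measurable D -> measurable_fun D (fun y : R => (K * expR (- (a * `|y|)) * 2^-1 ^+ n)%:E).
  move=> mD; apply/measurable_EFinP/measurable_funM => //; apply: measurable_funM => //.
  exact: measurable_funTS.
have pos t : (0 <= (K * expR (- (a * `|t|)) * 2^-1 ^+ n)%:E)%E.
  by rewrite lee_fin !mulr_ge0 ?expR_ge0 ?exprn_ge0.
apply: (@le_trans _ _ (\int[mu]_(t in `]-oo, 0%R[) (K * expR (- (a * `|t|)) * 2^-1 ^+ n)%:E)%E).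
  apply: ge0_le_integral => //.
  - by move=> t _; rewrite lee_fin mulr_ge0 ?powR_ge0 ?exprn_ge0 ?Phi_ge0.
  - by apply/measurable_EFinP; exact: measurable_powR_phi_Phi.
  - exact: meD.
  - move=> t; rewrite /= in_itv/= => t0; rewrite lee_fin.
    apply: ler_pM; rewrite ?powR_ge0 ?exprn_ge0 ?Phi_ge0//.
    rewrite lerXn2r ?nnegrE ?Phi_ge0//.
    by have := Q_decr t0; rewrite Q0 /Q; lra.
apply: (@le_trans _ _ (\int[mu]_t (K * expR (- (a * `|t|)) * 2^-1 ^+ n)%:E)%E).
  by apply: ge0_subset_integral => //; exact: meD.
under eq_integral do rewrite mulrAC EFinM.
rewrite ge0_integralZl//.
- by rewrite integral_expRN_norm// -EFinM lee_fin mulrAC.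
- exact/measurable_EFinP.
- by rewrite lee_fin mulr_ge0// exprn_ge0.
Qed.

End Assembly.

Theorem theorem5p1 (R : realType) (a : R) (a_gt0 : 0 < a) :
  (exists2 r : nat -> R,
     r =o_\oo (fun n => u n `^ (a - 3)) &
     \forall n \near \oo,
       (\int[@lebesgue_measure R]_t (phi t `^ a * Phi t ^+ n)%:E)%E =
       ((u n `^ (a - 1) * Gamma a
         + u n `^ (a - 3) * (a - 1) * (Gamma a - (Gamma^`())%classic a)
         + r n) / n%:R `^ a)%:E)
  /\
  (exists2 r : nat -> R,
     r =o_\oo (fun n => u (2 * n) `^ (a - 3)) &
     \forall n \near \oo,
       (\int[@lebesgue_measure R]_(t in `[0%R, +oo[)
          (phi t `^ a * (2 * Phi t - 1) ^+ n)%:E)%E =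
       ((u (2 * n) `^ (a - 1) * Gamma a
         + u (2 * n) `^ (a - 3) * (a - 1) * (Gamma a - (Gamma^`())%classic a)
         + r n) / (2 * n)%:R `^ a)%:E).
Proof.
have cE : forall x y : R, x * (a - 1) * y = x * ((a - 1) * y) by move=> x y; rewrite mulrA.
split.
- have [w [wI wG]] := @tail_integral_asymptotics R a 1 a_gt0 isT isT.
  have uy : u n @[n --> \oo] --> (+oo : set_system R).
    by move: (@cvg_u R 1 isT); under eq_fun do rewrite mul1n.
  have [M M0 hM] := left_integral_le a_gt0.
  pose E n : \bar R := (\int[@lebesgue_measure R]_(t in `]-oo, 0%R[) (phi t `^ a * Phi t ^+ n)%:E)%E.
  have E0 n : (0 <= E n)%E.
    by apply: integral_ge0 => t _; rewrite lee_fin mulr_ge0 ?powR_ge0 ?exprn_ge0 ?Phi_ge0.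
  have Ef n : E n \is a fin_num by rewrite ge0_fin_numE// (le_lt_trans (hM n)) ?ltry.
  (* The contribution of t < 0 in the normalisation n^-a u^(a-1), so that it simply adds to
     [w n]. *)
  pose e n := n%:R `^ a * fine (E n) / u n `^ (a - 1).
  have ecvg : u n ^+ 2 * e n @[n --> \oo] --> (0 : R).
    (* For u >= 1 and a > 0, u^(1-a) <= u^2; hence u^2 [e n] <= u^4 n^a M 2^-n, and u^4 <= n^2. *)
    apply: (@squeeze_cvgr _ _ _ _ (cst 0) (fun n => M * (n%:R `^ (a + 2) * 2^-1 ^+ n))); last 2 first.
    + exact: cvg_cst.
    + by rewrite -(mulr0 M); apply: cvgMr; exact: powR_half_cvg0.
    near=> n.
    have n0 : (0 < n)%N by near: n; exact: nbhs_infty_gt.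
    have n0' : 0 < n%:R :> R by rewrite ltr0n.
    have u1 : 1 <= u n :> R by near: n; move/cvgryPge : uy; exact.
    have un : u n ^+ 2 <= n%:R :> R.
      by near: n; apply: filterS (@u_sq_le R a 1 a_gt0 isT isT) => n; rewrite mul1n.
    have ua : 0 < u n `^ (a - 1) by rewrite powR_gt0//; lra.
    have En0 : 0 <= fine (E n) by rewrite fine_ge0.
    have EM : fine (E n) <= M * 2^-1 ^+ n by rewrite -lee_fin fineK//; exact: hM.
    apply/andP; split.
      by rewrite mulr_ge0 ?sqr_ge0// divr_ge0 ?mulr_ge0 ?powR_ge0.
    have uV : (u n `^ (a - 1))^-1 <= u n ^+ 2.
      rewrite -powRN -powR_mulrn; last lra.
      by apply: ler_powR => //; lra.
    have nn : u n ^+ 2 * u n ^+ 2 <= n%:R ^+ 2 :> R.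
      by rewrite (expr2 n%:R); apply: ler_pM; rewrite ?sqr_ge0.
    rewrite powRD; last by rewrite (gt_eqF n0') implybT.
    rewrite powR_mulrn; last exact: ltW.
    rewrite /e [leLHS](_ : _ = (u n ^+ 2 * (u n `^ (a - 1))^-1) * (n%:R `^ a * fine (E n))); last by ring.
    rewrite [leRHS](_ : _ = n%:R ^+ 2 * (n%:R `^ a * (M * 2^-1 ^+ n))); last by ring.
    apply: ler_pM.
    + by rewrite mulr_ge0 ?sqr_ge0// invr_ge0 ltW.
    + by rewrite mulr_ge0 ?powR_ge0.
    + by apply: le_trans nn; rewrite ler_wpM2l// sqr_ge0.
    + by rewrite ler_wpM2l// powR_ge0.
  have [||||r ro rE] := @littleo_expansion R
      (fun n => (\int[@lebesgue_measure R]_t (phi t `^ a * Phi t ^+ n)%:E)%E) id (fun n => w n + e n) a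
      (Gamma a) ((a - 1) * (Gamma a - (@Gamma R)^`()%classic a)).
  + by [].
  + exact: uy.
  + near=> n.
    have n0 : (0 < n)%N by near: n; exact: nbhs_infty_gt.
    have u0 : 0 < u n :> R by near: n; move/cvgryPgt : uy; exact.
    have Jn : (\int[@lebesgue_measure R]_(t in `[0%R, +oo[) (phi t `^ a * Phi t ^+ n)%:E =
        (n%:R `^ (- a) * u n `^ (a - 1) * w n)%:E)%E.
      rewrite -{2 3}[n]mul1n; have <- : (\int[@lebesgue_measure R]_(t in `[0%R, +oo[)
        (phi t `^ a * (1 - 1%:R * Q t) ^+ n)%:E =
        ((1 * n)%:R `^ (- a) * u (1 * n) `^ (a - 1) * w n)%:E)%E by near: n.
      by apply: eq_integral => t _; rewrite /Q; congr (_ * _ ^+ _)%:E; ring.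
    have -> : [set: R] = `]-oo, 0%R[ `|` `[0%R, +oo[ by rewrite -setCitvl setUv.
    rewrite ge0_integral_setU//; last 3 first.
    * by apply/measurable_EFinP; exact: measurable_powR_phi_Phi.
    * by move=> t _; rewrite lee_fin mulr_ge0 ?powR_ge0 ?exprn_ge0 ?Phi_ge0.
    * by rewrite -setCitvl; exact/disj_setPCl.
    rewrite Jn -/(E n) -(fineK (Ef n)) -EFinD; congr EFin.
    rewrite /e powRN; field.
    by rewrite !lt0r_neq0// powR_gt0// ltr0n.
  + rewrite -[X in _ --> X]addr0.
    apply: cvg_trans (cvgD wG ecvg); apply: near_eq_cvg; near=> n.
    by rewrite !fctE mul1n; ring.
  exists r => //; apply: filterS rE => n ->.
  by rewrite cE.
- have [w [wI wG]] := @tail_integral_asymptotics R a 2 a_gt0 isT isT.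
  have [||||r ro rE] := @littleo_expansion R (fun n => (\int[@lebesgue_measure R]_(t in `[0%R, +oo[)
          (phi t `^ a * (2 * Phi t - 1) ^+ n)%:E)%E) (fun n => 2 * n)%N w a
      (Gamma a) ((a - 1) * (Gamma a - (@Gamma R)^`()%classic a)).
  + by move=> n n0; rewrite muln_gt0.
  + exact: cvg_u.
  + apply: filterS wI => n <-; apply: eq_integral => t _.
    by rewrite /Q; congr (_ * _ ^+ _)%:E; ring.
  + exact: wG.
  exists r => //; apply: filterS rE => n ->.
  by rewrite cE.
Unshelve. all: end_near. Qed.
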